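(* Let $\mu>-1$, $\nu>\sigma>-1$ and $b>a>0$. Then the function $$x\mapsto \Omega_{\mu,\nu,\sigma,a,b}(x)=\left(\frac{b}{a}\right)^{\mu-\nu}\frac{I_{\mu}(a\sqrt{x})\,I_{\nu}(b\sqrt{x})}{I_{\mu}(b\sqrt{x})\,I_{\nu}(a\sqrt{x})}\cdot \frac{1}{2^{\sigma}\Gamma(\sigma+1)}\,\frac{(b\sqrt{x})^{\sigma}}{I_{\sigma}(b\sqrt{x})},\qquad x>0,$$ is the Laplace transform of an infinitely divisible distribution with support $[0,\infty)$.
   Context: $I_\mu$ is the modified Bessel function of the first kind of order $\mu$, and $\Gamma$ is the Euler gamma function. The Laplace transform of a probability distribution $\lambda$ on $[0,\infty)$ is $x\mapsto\int_0^\infty e^{-xt}d\lambda(t)$. A probability distribution $\lambda$ on $[0,\infty)$ is infinitely divisible if for every $n\in\mathbb{N}$ there is a probability distribution $\lambda_n$ on $[0,\infty)$ with $\int_0^\infty e^{-xt}d\lambda(t)=\left[\int_0^\infty e^{-xt}d\lambda_n(t)\right]^n$ for all $x>0$. *)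

(* Defs.v *)
From HB Require Import structures.
From mathcomp Require Import all_boot all_order all_algebra.
From mathcomp Require Import all_classical all_reals all_analysis.

Set Implicit Arguments.
Unset Strict Implicit.
Unset Printing Implicit Defensive.

Import Order.TTheory GRing.Theory Num.Theory.
Import numFieldNormedType.Exports.

Local Open Scope classical_set_scope.
Local Open Scope ring_scope.

(* Euler's integral; it represents the gamma function for z > 0 only. *)
Definition Gamma (R : realType) (z : R) : R :=
  \int[@lebesgue_measure R]_(t in `]0, +oo[) (t `^ (z - 1) * expR (- t)).

(* The defining series; meant for mu > -1 and x > 0, where every argument of
   Gamma is positive and the real powers have a positive base. *)
Definition besselI (R : realType) (mu x : R) : R :=
  limn (series (fun k : nat =>
    (x / 2) `^ (2 * k%:R + mu) / (k`!%:R * Gamma (k%:R + mu + 1)))).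

Definition Omega (R : realType) (mu nu sigma a b x : R) : R :=
  (b / a) `^ (mu - nu)
  * ((besselI mu (a * Num.sqrt x) * besselI nu (b * Num.sqrt x))
     / (besselI mu (b * Num.sqrt x) * besselI nu (a * Num.sqrt x)))
  * (1 / (2 `^ sigma * Gamma (sigma + 1))
     * ((b * Num.sqrt x) `^ sigma / besselI sigma (b * Num.sqrt x))).

(* Distributions on [0, +oo[ are Borel probabilities on R carried by it. *)
Definition on_half_line (R : realType)
    (lam : probability (measurableTypeR R) R) : Prop :=
  lam `[0, +oo[%classic = 1%E.

Definition laplace (R : realType) (lam : probability (measurableTypeR R) R)
    (x : R) : R :=
  \int[lam]_(t in `[0, +oo[) expR (- (x * t)).

Definition infinitely_divisible (R : realType)
    (lam : probability (measurableTypeR R) R) : Prop :=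
  forall n : nat, (0 < n)%N ->
    exists lam_n : probability (measurableTypeR R) R,
      on_half_line lam_n /\
      forall x : R, 0 < x -> laplace lam x = laplace lam_n x ^+ n.

Definition measure_support (R : realType)
    (lam : probability (measurableTypeR R) R) : set R :=
  [set t | forall U : set R, open U -> U t -> (0 < lam U)%E].

(* Main.v *)
(* Write f_nu(y) = sum_k y^k / (k! (nu+1)_k), so that I_nu(x) is
   (x/2)^nu f_nu(x^2/4) / Gamma(nu+1) and Omega(x) equals
     f_mu(A x) / f_mu(B x) * f_nu(B x) / f_sigma(B x) * 1 / f_nu(A x)
   with A = a^2/4 < B = b^2/4.  The recurrence
     f_nu = f_(nu+1) + y / ((nu+1)(nu+2)) f_(nu+2)
   makes f_nu a limit of continuants, i.e. matching polynomials of a path whose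
   i-th vertex has weight 1/(nu+i); these decrease in nu and scale with a, b.
   So each factor of Omega is a limit of quotients K(e')/K(e) of continuants with
   e' <= e entrywise, and the weights can be changed one at a time: such a step
   is (1 + e' psi)/(1 + e psi), where by the spectral theorem for a
   skew-symmetric path matrix psi is a sum of terms c x/(1 + d x) with
   c, d >= 0.  It is a mixture of 1 and of the transform of a compound geometric
   law, and its m-th root is a limit of products of such steps.  Hence no zeros of
   Bessel functions are needed; the class of Laplace transforms only has to be
   closed under mixtures, products and limits.  For the support, split off one
   exponential factor from Omega: the remaining law charges every neighbourhood
   of 0, since f_nu grows subexponentially. *)
Require Import Defs.
From HB Require Import structures.
From mathcomp Require Import all_boot all_order all_algebra.
From mathcomp Require Import all_classical all_reals all_analysis.
From mathcomp Require Import measurable_realfun complex ring lra.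

Set Implicit Arguments.
Unset Strict Implicit.
Unset Printing Implicit Defensive.

Import Order.TTheory GRing.Theory Num.Theory.
Import numFieldNormedType.Exports.
Local Open Scope classical_set_scope.
Local Open Scope ring_scope.

(** * Laplace transforms of laws on the half line *)

(** A pointwise limit of transforms may lose mass at infinity, so each passage to the limit carries
    a bound [1 - C * x <= g x], which keeps [g] close to [1] near [0]. Roots are real powers of
    exponent [m%:R^-1]; as transforms take values between [0] and [1], a root of [g] is at least [g]
    and inherits that bound. With y = c^2 x, the coefficient y / ((nu+1)(nu+2)) of the recurrence is
    split as x times c/(nu+1) times c/(nu+2). This puts the weights on the vertices of the path
    instead of its edges: a matching meets a vertex at most once, so a continuant is affine in each
    weight, and a change of either the order or the scale becomes an entrywise comparison of two
    words. The scale c is the square root a/2 of A, or b/2 of B. *)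

Definition is_laplace (R : realType) (g : R -> R) :=
  exists lam : probability (measurableTypeR R) R,
    on_half_line lam /\ forall x, 0 < x -> laplace lam x = g x.

(** The proof of total mass one is an argument of the alias, so that a probability structure can be
    attached to it by inference. *)
Definition unit_measure d (T : measurableType d) (R : realType)
  (m : {measure set T -> \bar R}) (m1 : m setT = 1%E) : set T -> \bar R := m.

HB.instance Definition _ d (T : measurableType d) (R : realType)
    (m : {measure set T -> \bar R}) (m1 : m setT = 1%E) :=
  Measure.copy (unit_measure m1) m.

HB.instance Definition _ d (T : measurableType d) (R : realType)
    (m : {measure set T -> \bar R}) (m1 : m setT = 1%E) :=
  Measure_isProbability.Build _ _ _ (unit_measure m1) m1.

Lemma probability_of_measure d (T : measurableType d) (R : realType)
    (m : {measure set T -> \bar R}) : m setT = 1%E ->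
  exists P : probability T R, forall A, P A = m A.
Proof. by move=> m1; exists (unit_measure m1). Qed.

Lemma measurable_expRM (R : realType) (x : R) (D : set R) :
  measurable_fun D (fun t : R => (expR (- (x * t)))%:E).
Proof.
apply/measurable_EFinP; apply: measurable_funTS.
apply: measurableT_comp; first exact: measurable_expR.
by apply: measurable_funN; exact: measurable_funM.
Qed.

Lemma laplaceE (R : realType) (lam : probability (measurableTypeR R) R) (x : R) :
  0 <= x ->
  (laplace lam x)%:E = (\int[lam]_(t in `[0%R, +oo[) (expR (- (x * t)))%:E)%E.
Proof.
move=> x0; rewrite /laplace /Rintegral fineK//.
have h0 : (0 <= \int[lam]_(t in `[0%R, +oo[) (expR (- (x * t)))%:E)%E.
  by apply: integral_ge0 => t _; rewrite lee_fin expR_ge0.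
rewrite ge0_fin_numE//.
apply: (@le_lt_trans _ _ (\int[lam]_(t in `[0%R, +oo[) (cst 1%E t))%E).
  apply: ge0_le_integral => //.
  - exact: measurable_expRM.
  - move=> t; rewrite /= in_itv/= andbT => t0; rewrite lee_fin -expR0 ler_expR.
    by rewrite oppr_le0 mulr_ge0.
rewrite integral_cst ?mul1e//.

apply: (@le_lt_trans _ _ 1%E); [exact: probability_le1|exact: ltry].
Qed.

Lemma half_line_setC (R : realType) (lam : probability (measurableTypeR R) R) :
  on_half_line lam -> lam (~` `[0, +oo[%classic) = 0%E.
Proof.
move=> h; rewrite probability_setC//.
by rewrite h subee.
Qed.

Lemma integral_half_line (R : realType) (lam : probability (measurableTypeR R) R)
    (f : R -> \bar R) : on_half_line lam -> measurable_fun setT f ->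
  (forall t, 0 <= f t)%E ->
  (\int[lam]_t f t = \int[lam]_(t in `[0%R, +oo[) f t)%E.
Proof.
move=> h mf f0.
have mD : measurable (`[0%R, +oo[%classic : set (measurableTypeR R)).
  exact: measurable_itv.
rewrite (ge0_negligible_integral (measurableC mD) measurableT) //.
  by rewrite setTD setCK.
exact: half_line_setC.
Qed.

Lemma is_laplace1 (R : realType) : is_laplace (fun _ : R => 1).
Proof.
exists (dirac (0 : measurableTypeR R)); split.
  rewrite /on_half_line/= /dirac.
  by rewrite indicE mem_set//= in_itv/= lexx.
move=> x x0; apply: EFin_inj; rewrite laplaceE ?ltW//.
rewrite integral_dirac.
- by rewrite diracE mem_set ?mul1e ?mulr0 ?oppr0 ?expR0//= in_itv/= lexx.
- exact: measurable_itv.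
- exact: measurable_expRM.
Qed.

Lemma is_laplace_ext (R : realType) (f g : R -> R) :
  (forall x, 0 < x -> f x = g x) -> is_laplace f -> is_laplace g.
Proof. by move=> fg [l [h1 h2]]; exists l; split => // x x0; rewrite h2// fg. Qed.

Lemma is_laplace_mix (R : realType) (p : R) (f g : R -> R) : 0 <= p -> p <= 1 ->
  is_laplace f -> is_laplace g ->
  is_laplace (fun x => p * f x + (1 - p) * g x).
Proof.
move=> p0 p1 [l1 [h1 e1]] [l2 [h2 e2]].
have q0 : 0 <= 1 - p by rewrite subr_ge0.
pose m := measure_add (mscale (NngNum p0) l1) (mscale (NngNum q0) l2).
have mE A : m A = (p%:E * l1 A + (1 - p)%:E * l2 A)%E.
  by rewrite /m measure_addE /mscale/=.
have [|P HP] := @probability_of_measure _ _ _ m.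
  apply: (etrans (mE setT)).
  by rewrite !probability_setT !mule1 -EFinD addrC subrK.
have mD : measurable (`[0%R, +oo[%classic : set (measurableTypeR R)).
  exact: measurable_itv.
exists P; split.
  apply: (etrans (HP _)); apply: (etrans (mE _)).
  by rewrite h1 h2 !mule1 -EFinD addrC subrK.
move=> x x0; apply: EFin_inj; rewrite laplaceE ?ltW//.
have -> : (\int[P]_(t in `[0%R, +oo[) (expR (- (x * t)))%:E =
           \int[m]_(t in `[0%R, +oo[) (expR (- (x * t)))%:E)%E.
  by apply: eq_measure_integral => A _ _; exact: HP.
have e0 t : (0 <= (expR (- (x * t)))%:E)%E by rewrite lee_fin expR_ge0.
rewrite ge0_integral_measure_add//; last exact: measurable_expRM.
rewrite !ge0_integral_mscale//; try exact: measurable_expRM.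
by rewrite -!laplaceE ?ltW//= e1// e2// -!EFinM -EFinD.
Qed.

(** The law of the sum of two independent variables. The last clause records what the transform does
    not show directly, a lower bound for the mass of sets that contain a sum set; the support is
    read off from it. *)
Lemma convolution_exists (R : realType)
    (l1 l2 : probability (measurableTypeR R) R) :
  on_half_line l1 -> on_half_line l2 ->
  exists P : probability (measurableTypeR R) R,
  [/\ on_half_line P,
      (forall x, 0 < x -> laplace P x = laplace l1 x * laplace l2 x) &
      forall A B U : set (measurableTypeR R),
        measurable A -> measurable B -> measurable U ->
        (forall s t : R, A s -> B t -> U (s + t)) -> (l1 A * l2 B <= P U)%E].
Proof.
move=> h1 h2.
have mphi : measurable_fun setT
    (fun z : measurableTypeR R * measurableTypeR R => z.1 + z.2 : measurableTypeR R).
  by apply: measurable_funD; [exact: measurable_fst|exact: measurable_snd].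
have mphi0 := mphi.
pose phi : {mfun (measurableTypeR R * measurableTypeR R)%type >-> measurableTypeR R} :=
  HB.pack (fun z : measurableTypeR R * measurableTypeR R => z.1 + z.2 : measurableTypeR R)
   (isMeasurableFun.Build _ _ _ _ _ mphi0).
pose P : probability (measurableTypeR R) R := distribution (l1 \x l2)%E phi.
have mD : measurable (`[0%R, +oo[%classic : set (measurableTypeR R)).
  exact: measurable_itv.
have PU (A B U : set (measurableTypeR R)) :
   measurable A -> measurable B -> measurable U ->
   (forall s t : R, A s -> B t -> U (s + t)) -> (l1 A * l2 B <= P U)%E.
  move=> mA mB mU ABU; rewrite -product_measure1E//.
  apply: le_measure; rewrite ?inE//.
  - exact: measurableX.
  - by rewrite -[X in measurable X]setTI; exact: mphi.
  - by move=> [s t] [/= As Bt]; exact: ABU.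
have hP : on_half_line P.
  apply/eqP; rewrite eq_le probability_le1//=.
  have DD (s t : R) : `[0%R, +oo[%classic s -> `[0%R, +oo[%classic t ->
      `[0%R, +oo[%classic (s + t).
    by rewrite /= !in_itv/= !andbT; exact: addr_ge0.
  by have := PU _ _ _ mD mD mD DD; rewrite h1 h2 mule1.
exists P; split => //.
move=> x x0; apply: EFin_inj; rewrite EFinM !laplaceE ?ltW//.
have e0 t : (0 <= (expR (- (x * t)))%:E)%E by rewrite lee_fin expR_ge0.
have me := @measurable_expRM R x setT.
rewrite -!integral_half_line//.
rewrite ge0_integral_distribution//=.
rewrite fubini_tonelli1//=; last exact: (measurableT_comp me mphi).
under eq_integral => s _.
  rewrite /fubini_F/=.
  under eq_integral => t _ do rewrite mulrDr opprD expRD EFinM.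
  rewrite ge0_integralZl//.
  over.
by rewrite ge0_integralZr//; exact: integral_ge0.
Qed.

Lemma is_laplaceM (R : realType) (f g : R -> R) :
  is_laplace f -> is_laplace g -> is_laplace (fun x => f x * g x).
Proof.
move=> [l1 [h1 e1]] [l2 [h2 e2]].
have [P [hP eP _]] := convolution_exists h1 h2.
by exists P; split => // x x0; rewrite eP// e1// e2.
Qed.

Lemma continuous_powR (R : realType) (p x : R) : 0 < x ->
  {for x, continuous (fun t : R => t `^ p)}.
Proof.
move=> x0; apply: differentiable_continuous; apply/derivable1_diffP.
by apply: derivable_powR; rewrite in_itv/= andbT.
Qed.

Lemma integral_powR01 (R : realType) (p : R) : 0 < p ->
  (\int[lebesgue_measure]_(u in `[0%R, 1%R]) (u `^ p)%:E = (p + 1)^-1%:E)%E.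
Proof.
move=> p0.
have p1 : p + 1 != 0 by rewrite gt_eqF// addr_gt0.
rewrite (@continuous_FTC2 R _ (fun u => (p + 1)^-1 * u `^ (p + 1)))//.
- by rewrite powR1 mulr1 powR0// mulr0 sube0.
- apply/continuous_within_itvP => //; split.
  + by move=> x; rewrite in_itv/= => /andP[x0 _]; exact: continuous_powR.
  + by rewrite powR0 ?gt_eqF//; exact: powR_cvg0.
  + by apply: cvg_at_left_filter; exact: continuous_powR.
- split.
  + move=> x; rewrite in_itv/= => /andP[x0 _].
    by apply: derivableM => //; apply: derivable_powR; rewrite in_itv/= andbT.
  + apply: cvgMl_tmp; rewrite powR0//; apply: powR_cvg0; exact: addr_gt0.
  + by apply: cvgMl_tmp; apply: cvg_at_left_filter; exact: continuous_powR.
- move=> x; rewrite in_itv/= => /andP[x0 _].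
  rewrite derive1E deriveMl; last by apply: derivable_powR; rewrite in_itv/= andbT.
  have [_ ->] := is_derive1_powR (p + 1) x0.
  by rewrite mulrA mulVf// mul1r addrK.
Qed.

(** If [u] is uniform on the unit interval, [beta * |ln u|] is exponential of mean [beta], and its
    transform is the integral of the power of [u] of exponent [x * beta]. The absolute value makes
    the variable nonnegative on the whole line, so that the law is carried by the half line without
    any null set. *)
Lemma exponential_law (R : realType) (beta : R) : 0 < beta ->
  exists P : probability (measurableTypeR R) R,
  [/\ on_half_line P,
      (forall x, 0 < x -> laplace P x = (1 + beta * x)^-1) &
      forall c d : R, 0 <= c -> c < d -> (0 < P `]c, d[%classic)%E].
Proof.
move=> b0.
have mX : measurable_fun setT
    (fun u : measurableTypeR R => beta * `|ln u| : measurableTypeR R).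
  apply: measurable_funM => //.
  by apply: measurableT_comp => //; exact: measurable_ln.
have mX0 := mX.
pose X : {mfun measurableTypeR R >-> measurableTypeR R} :=
  HB.pack (fun u : measurableTypeR R => beta * `|ln u| : measurableTypeR R)
    (isMeasurableFun.Build _ _ _ _ _ mX0).
pose P : probability (measurableTypeR R) R :=
  distribution (uniform_prob (ltr01 : 0 < 1 :> R)) X.
have hP : on_half_line P.
  rewrite /on_half_line /P /distribution/= /pushforward.
  rewrite (_ : _ @^-1` _ = setT) ?probability_setT//.
  apply/seteqP; split => // u _ /=; rewrite in_itv/= andbT.
  by rewrite mulr_ge0// ltW.
exists P; split => //.
- move=> x x0; apply: EFin_inj; rewrite laplaceE ?ltW//.
  have e0 t : (0 <= (expR (- (x * t)))%:E)%E by rewrite lee_fin expR_ge0.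
  have me := @measurable_expRM R x setT.
  rewrite -!integral_half_line// ge0_integral_distribution//=.
  rewrite integral_uniform//; last exact: (measurableT_comp me mX).
  rewrite subr0 invr1 mul1e.
  rewrite mulrC addrC -(@integral_powR01 _ (x * beta)) ?mulr_gt0//.
  (* At [u = 0] the convention [ln 0 = 0] gives the value 1 on the left and 0 on the right, hence
     the endpoint is removed from both integrals. *)
  rewrite -[LHS]integral_itv_obnd_cbnd; last first.
    by apply: measurable_funTS; exact: (measurableT_comp me mX).
  rewrite -[RHS]integral_itv_obnd_cbnd; last first.
    by apply/measurable_EFinP; apply: measurable_funTS; exact: measurable_powR.
  apply: eq_integral => u; rewrite inE/= in_itv/= => /andP[u0 u1].
  rewrite /powR gt_eqF// ler0_norm; last exact: ln_le0.
  by rewrite !mulrN opprK mulrA.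
- move=> c d c0 cd.
  pose I : set R := `]expR (- (d / beta)), expR (- (c / beta))[%classic.
  have cd' : expR (- (d / beta)) < expR (- (c / beta)).
    by rewrite ltr_expR ltrN2 ltr_pM2r// invr_gt0.
  have I01 : I `<=` `[0, 1].
    move=> u; rewrite /I/= !in_itv/= => /andP[u0 u1].
    rewrite (le_trans _ (ltW u0)) ?expR_ge0//= (le_trans (ltW u1))//.
    by rewrite -expR0 ler_expR oppr_le0 divr_ge0// ltW.
  have IX : I `<=` X @^-1` `]c, d[%classic.
    move=> u; rewrite /I/= !in_itv/= => /andP[u0 u1].
    have u_gt0 : 0 < u by apply: lt_trans u0; exact: expR_gt0.
    have uu : u \is Num.pos by rewrite posrE.
    have l1 : ln u < - (c / beta) by rewrite -ltr_expR lnK.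
    have l2 : - (d / beta) < ln u by rewrite -ltr_expR lnK.
    have l3 : ln u <= 0.
      by apply: (le_trans (ltW l1)); rewrite oppr_le0 divr_ge0// ltW.
    rewrite ler0_norm// mulrC -ltr_pdivrMr// -[X in _ && X]ltr_pdivlMr//.
    by apply/andP; split; [rewrite ltrNr|rewrite ltrNl].
  apply: (@lt_le_trans _ _ (uniform_prob (ltr01 : 0 < 1 :> R) I)); last first.
    apply: le_measure; rewrite ?inE//; first exact: measurable_itv.
    by rewrite -[X in measurable X]setTI; exact: mX.
  rewrite /uniform_prob integral_uniform_pdf setIidl//.
  rewrite (eq_integral (fun=> 1%E)); last first.
    move=> u; rewrite inE => /I01; rewrite /= in_itv/= /uniform_pdf => ->.
    by rewrite subr0 invr1.
  rewrite (@integral_cst _ _ _ lebesgue_measure I _ 1%E)//; last exact: measurable_itv.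
  rewrite mul1e.
  have muI : (0 < lebesgue_measure I)%E.
    by rewrite /I lebesgue_measure_itv/= lte_fin cd' -EFinB lte_fin subr_gt0.
  exact: muI.
Qed.

(** * Pointwise limits of Laplace transforms *)

Definition cdfR (R : realType) (lam : probability (measurableTypeR R) R) (t : R) : R :=
  fine (lam `]-oo, t]%classic).

Lemma cdfRE (R : realType) (lam : probability (measurableTypeR R) R) (t : R) :
  (cdfR lam t)%:E = lam `]-oo, t]%classic.
Proof. by rewrite /cdfR fineK// fin_num_measure. Qed.

Lemma cdfR_ge0 (R : realType) (lam : probability (measurableTypeR R) R) (t : R) :
  0 <= cdfR lam t.
Proof. by rewrite -lee_fin cdfRE. Qed.

Lemma cdfR_le1 (R : realType) (lam : probability (measurableTypeR R) R) (t : R) :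
  cdfR lam t <= 1.
Proof. by rewrite -lee_fin cdfRE probability_le1. Qed.

Lemma cdfR_homo (R : realType) (lam : probability (measurableTypeR R) R) :
  {homo cdfR lam : s t / s <= t}.
Proof.
move=> s t st; rewrite -lee_fin !cdfRE; apply: le_measure; rewrite ?inE//.
by move=> u; rewrite /= !in_itv/= => /le_trans; apply.
Qed.

Lemma cdfR_lt0 (R : realType) (lam : probability (measurableTypeR R) R) (t : R) :
  on_half_line lam -> t < 0 -> cdfR lam t = 0.
Proof.
move=> h t0; apply/eqP; rewrite eq_le cdfR_ge0 andbT -lee_fin cdfRE.
rewrite -[leRHS](half_line_setC h); apply: le_measure; rewrite ?inE//.
  by apply: measurableC; exact: measurable_itv.
move=> u; rewrite /= !in_itv/= andbT => ut; apply/negP; rewrite -ltNge.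
exact: le_lt_trans t0.
Qed.

Lemma integral_step (R : realType) (lam : probability (measurableTypeR R) R)
    (K : nat) (c u : nat -> R) : (forall k, 0 <= c k) ->
  (\int[lam]_t (\sum_(k < K) c k * \1_(`]-oo, u k]%classic : set R) t)%:E =
   (\sum_(k < K) c k * cdfR lam (u k))%:E)%E.
Proof.
move=> c0; under eq_integral do rewrite -sumEFin.
have mi k : measurable_fun setT
    (fun t : measurableTypeR R => (\1_(`]-oo, u k]%classic : set R) t)%:E).
  by apply/measurable_EFinP; exact: measurable_indic.
rewrite (@ge0_integral_sum _ _ _ lam setT measurableT _
   (fun (k : 'I_K) t => (c k * \1_(`]-oo, u k]%classic : set R) t)%:E)).
- rewrite -sumEFin; apply: eq_bigr => k _.
  under eq_integral do rewrite EFinM.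
  rewrite ge0_integralZl//; last by rewrite lee_fin.
  by rewrite integral_indic// setIT EFinM cdfRE.
- by move=> k; under eq_fun do rewrite EFinM; exact: measurable_funeM.
- by move=> k t _; rewrite lee_fin mulr_ge0.
Qed.

Lemma measurable_step (R : realType) (K : nat) (c u : nat -> R) :
  measurable_fun (setT : set (measurableTypeR R))
   (fun t => (\sum_(k < K) c k * \1_(`]-oo, u k]%classic : set R) t)%:E).
Proof.
apply/measurable_EFinP; apply: measurable_sum => k.
by apply: measurable_funM => //; exact: measurable_indic.
Qed.

(** * Lower and upper sums for the Laplace integral *)

Section laplace_step.
Context {R : realType} {x delta : R} (x0 : 0 < x) (delta0 : 0 < delta).

Let q := expR (- (x * delta)).

Let q_gt0 : 0 < q. Proof. exact: expR_gt0. Qed.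

Let qX k : q ^+ k = expR (- (x * (k%:R * delta))).
Proof. by rewrite /q -expRM_natr mulNr mulrAC mulrA. Qed.

Let q_le1 : q <= 1.
Proof. by rewrite -expR0 ler_expR oppr_le0 mulr_ge0// ltW. Qed.

(** The drop of [expR (- (x * t))] across the [k]-th cell of width [delta]. Indicators of
    [t <= k * delta] weighted by these drops stay below the exponential; with [k.+1] and the
    remainder [q ^+ K] they stay above it. Integration leaves finite sums of values of the
    distribution function, which pass to the limit along any filter. *)
Let c k := q ^+ k - q ^+ k.+1.

Let c_ge0 k : 0 <= c k.
Proof.
by rewrite /c exprS -{1}[q ^+ k]mul1r -mulrBl mulr_ge0 ?subr_ge0// exprn_ge0// ltW.
Qed.

Let indE (t u : R) : \1_(`]-oo, u]%classic : set R) t = (t <= u)%R%:R :> R.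
Proof.
rewrite indicE; congr (_%:R : R); congr nat_of_bool.
by apply/idP/idP; rewrite inE/= in_itv.
Qed.

(** The induction on [K] needs the exact deficit [q ^+ K] up to the horizon [K * delta]; beyond it
    that bound would be negative while the sum is zero, hence two cases. *)
Let step_le K t :
  (t <= K%:R * delta ->
    \sum_(k < K) c k * \1_(`]-oo, k%:R * delta]%classic : set R) t <=
      expR (- (x * t)) - q ^+ K) /\
  (K%:R * delta <= t ->
    \sum_(k < K) c k * \1_(`]-oo, k%:R * delta]%classic : set R) t <= 0).
Proof.
elim: K => [|K [IH1 IH2]].
  rewrite !big_ord0 expr0 mul0r; split => // t0.
  by rewrite subr_ge0 -expR0 ler_expR oppr_ge0 pmulr_rle0.
rewrite big_ord_recr/= indE.
have [tK|tK] := leP t (K%:R * delta).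
  rewrite mulr1; split => [_|].
    by rewrite (le_trans (lerD (IH1 tK) (lexx _)))// /c addrA subrK.
  by move=> /le_trans/(_ tK); rewrite ler_pM2r// ler_nat ltnn.
rewrite mulr0 addr0; split => [tK1|_]; last exact/IH2/ltW.
rewrite (le_trans (IH2 (ltW tK)))// subr_ge0 qX ler_expR lerN2.
by rewrite ler_pM2l.
Qed.

Let step_le_exp K t :
  \sum_(k < K) c k * \1_(`]-oo, k%:R * delta]%classic : set R) t <=
      expR (- (x * t)).
Proof.
have [tK|tK] := leP t (K%:R * delta).
  by rewrite (le_trans ((step_le K t).1 tK))// gerBl exprn_ge0// ltW.
by rewrite (le_trans ((step_le K t).2 (ltW tK)))// expR_ge0.
Qed.

Let exp_le_step K t : 0 <= t ->
  expR (- (x * t)) <=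
  \sum_(k < K) c k * \1_(`]-oo, k.+1%:R * delta]%classic : set R) t + q ^+ K.
Proof.
move=> t0; elim: K => [|K IH].
  by rewrite big_ord0 add0r expr0 -expR0 ler_expR oppr_le0 mulr_ge0// ltW.
rewrite big_ord_recr/= indE; have [tK|tK] := leP t (K.+1%:R * delta).
  by rewrite mulr1 /c -addrA subrK.
rewrite mulr0 addr0 (@le_trans _ _ (q ^+ K.+1))//.
  by rewrite qX ler_expR lerN2 ler_pM2l// ltW.
rewrite lerDr sumr_ge0// => k _.
by rewrite mulr_ge0// indE.
Qed.

Lemma laplace_ge_step (lam : probability (measurableTypeR R) R) K :
  on_half_line lam ->
  \sum_(k < K) c k * cdfR lam (k%:R * delta) <= laplace lam x.
Proof.
have me := @measurable_expRM R x setT.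
move=> h; rewrite -lee_fin laplaceE ?(ltW x0)// -integral_half_line//.
rewrite -(@integral_step _ lam K c (fun k => k%:R * delta))//.
apply: ge0_le_integral => //.
- move=> t _; rewrite lee_fin sumr_ge0// => k _; by rewrite mulr_ge0.
- exact: (@measurable_step R K c (fun k => k%:R * delta)).
- by move=> t _; rewrite lee_fin.
Qed.

Lemma laplace_le_step (lam : probability (measurableTypeR R) R) K :
  on_half_line lam ->
  laplace lam x <= \sum_(k < K) c k * cdfR lam (k.+1%:R * delta) + q ^+ K.
Proof.
move=> h; rewrite -lee_fin laplaceE ?(ltW x0)// EFinD.
rewrite -(@integral_step _ lam K c (fun k => k.+1%:R * delta))//.
have s0 t : (0 <= (\sum_(k < K)
    c k * \1_(`]-oo, k.+1%:R * delta]%classic : set R) t)%:E)%E.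
  by rewrite lee_fin sumr_ge0// => k _; rewrite mulr_ge0.
have qE : ((q ^+ K)%:E = \int[lam]_(t in `[0%R, +oo[) (cst (q ^+ K)%:E t))%E.
  by rewrite integral_cst//= h mule1.
have ms := @measurable_step R K c (fun k => k.+1%:R * delta).
rewrite qE integral_half_line//.
rewrite -ge0_integralD//; last 2 first.
- by apply: measurable_funTS.
- by move=> t _; rewrite lee_fin exprn_ge0// ltW.
apply: ge0_le_integral => //.
- exact: measurable_expRM.
- apply: emeasurable_funD => //; exact: measurable_funTS.
- move=> t; rewrite /= in_itv/= andbT => t0.
  by rewrite -EFinD lee_fin exp_le_step.
Qed.

End laplace_step.

(** Compactness gives a cluster point, and it is a limit because an ultrafilter contains each
    neighbourhood's preimage or its complement. *)
Lemma ultralimit_itv01 (R : realType) (G : set_system nat) (u : nat -> R) :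
  UltraFilter G -> (forall n, 0 <= u n <= 1) -> exists l : R, u n @[n --> G] --> l.
Proof.
move=> UG u01.
have PG : ProperFilter G by exact: ultra_proper.
have [|l [_ cl]] := @segment_compact R 0 1 (u @ G) _.
  by apply: (@filterE _ G _ (u @^-1` `[0, 1])) => n; have := u01 n; rewrite /= in_itv.
exists l => U lU.
have [//|GU] := in_ultra_setVsetC (u @^-1` U) UG.
by have [y [/= yU]] := cl (~` U) U GU lU.
Qed.

(** * From a nondecreasing limit of distribution functions to a law *)

Section right_regularization.
Context {R : realType} (f : R -> R) (f_nd : {homo f : s t / s <= t})
  (f_ge0 : forall t, 0 <= f t) (f_le1 : forall t, f t <= 1)
  (f_lt0 : forall t, t < 0 -> f t = 0)
  (f_y : forall e, 0 < e -> exists t, 1 - e <= f t).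

(** The right limit of [f] at [t]. A limit of distribution functions is nondecreasing but need not
    be right-continuous, as a Stieltjes measure requires. The values of [rreg] lie between [f t] and
    any later value of [f], so the change costs one cell in the sums above. *)
Definition rreg (t : R) := inf [set f s | s in [set s | t < s]].

Let E_lb t : has_lbound [set f s | s in [set s | t < s]].
Proof. by exists 0 => _ [s _ <-]. Qed.

Let E_inf t : has_inf [set f s | s in [set s | t < s]].
Proof. by split => //; exists (f (t + 1)), (t + 1) => //=; rewrite ltrDl. Qed.

Lemma rreg_le s t : s < t -> rreg s <= f t.
Proof. by move=> st; apply: ge_inf => //; exists t. Qed.

Lemma le_rreg t : f t <= rreg t.
Proof.
apply: lb_le_inf; first exact: (E_inf t).1.
by move=> _ [s ts <-]; apply/f_nd/ltW.
Qed.

Lemma rreg_nd : nondecreasing rreg.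
Proof.
move=> s t; rewrite le_eqVlt => /predU1P[->//|st].
exact: le_trans (rreg_le st) (le_rreg t).
Qed.

Lemma rreg_rc : right_continuous rreg.
Proof.
move=> t; apply/cvgrPdist_le => e e0.
have [_ [s ts <-] fs] := inf_adherent e0 (E_inf t).
near=> u.
have tu : t <= u by near: u; exact: nbhs_right_ge.
have us : u < s by near: u; exact: nbhs_right_lt.
rewrite distrC ger0_norm ?subr_ge0 ?rreg_nd// lerBlDl.
by rewrite (le_trans (rreg_le us))// ltW.
Unshelve. all: end_near. Qed.

Lemma rreg_Ny : rreg t @[t --> -oo] --> (0 : R).
Proof.
apply: (@cvg_trans _ ((fun=> 0) @ -oo)); last exact: cvg_cst.
apply: near_eq_cvg; near=> t.
have t0 : t < -1 by near: t; exact: nbhs_ninfty_lt.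
apply/eqP; rewrite eq_le (le_trans _ (le_rreg _))//.
by rewrite -(f_lt0 (t := -1)) ?rreg_le// ltrN10.
Unshelve. all: end_near. Qed.

Lemma rreg_y : rreg t @[t --> +oo] --> (1 : R).
Proof.
apply/cvgrPdist_le => e e0.
have [t0 ft0] := f_y e0.
near=> t.
have tt0 : t0 <= t by near: t; apply: nbhs_pinfty_ge; rewrite num_real.
have r1 : rreg t <= 1.
  by apply: (le_trans (rreg_le (t := t + 1) _)) => //; rewrite ltrDl.
rewrite ger0_norm ?subr_ge0//.
by rewrite lerBlDr -lerBlDl (le_trans ft0)// (le_trans (f_nd tt0))// le_rreg.
Unshelve. all: end_near. Qed.

HB.instance Definition _ := isCumulative.Build R _ R rreg rreg_nd rreg_rc.

HB.instance Definition _ := isCumulativeBounded.Build R 0 1 rreg rreg_Ny rreg_y.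

(* Pushing forward along [max(., 0)] avoids computing the mass of [`]-oo, 0[]. *)
Lemma rreg_probability : exists P : probability (measurableTypeR R) R,
  on_half_line P /\ forall t, 0 <= t -> cdfR P t = rreg t.
Proof.
have mX : measurable_fun setT
    (fun u : measurableTypeR R => Num.max u 0 : measurableTypeR R).
  by apply: measurable_maxr => //; exact: measurable_id.
pose X : {mfun measurableTypeR R >-> measurableTypeR R} :=
  HB.pack (fun u : measurableTypeR R => Num.max u 0 : measurableTypeR R)
    (isMeasurableFun.Build _ _ _ _ _ mX).
pose P0 : probability (measurableTypeR R) R := lebesgue_stieltjes_measure rreg.
exists (distribution P0 X); split.
  rewrite /on_half_line /distribution/= /pushforward.
  rewrite (_ : _ @^-1` _ = setT) ?probability_setT//.
  by apply/seteqP; split => // u _ /=; rewrite in_itv/= andbT le_max lexx orbT.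
move=> t t0; apply: EFin_inj; rewrite cdfRE -cdf_lebesgue_stieltjes_id.
rewrite /cdf /distribution /pushforward/=; congr (lebesgue_stieltjes_measure _ _).
by apply/seteqP; split => u /=; rewrite !in_itv/= ge_max t0 andbT.
Qed.

End right_regularization.

Lemma cvg_expR_inv (R : realType) (x : R) :
  expR (- (x * n.+1%:R^-1)) @[n --> \oo] --> (1 : R).
Proof.
rewrite [X in _ --> X](_ : 1 = expR (- (x * 0))); last first.
  by rewrite mulr0 oppr0 expR0.
apply: continuous_cvg; first exact: continuous_expR.
by apply: cvgN; apply: cvgMl_tmp; exact: cvg_harmonic.
Qed.

Lemma cvg_expR_oppMn (R : realType) (x : R) : 0 < x ->
  expR (- (x * n.+1%:R)) @[n --> \oo] --> (0 : R).
Proof.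
move=> x0; have q1 : `|expR (- x)| < 1.
  by rewrite ger0_norm ?expR_ge0// expR_lt1 oppr_lt0.
have := cvg_expr q1; rewrite -cvg_shiftS; apply: cvg_trans.
apply: near_eq_cvg; near=> n.
by rewrite /= -expRM_natr mulNr.
Unshelve. all: end_near. Qed.

(* Helly selection along an ultrafilter: the limit of the distribution functions
   exists at every point, and bounds by finite sums replace dominated convergence,
   which fails for ultrafilters. *)
Lemma is_laplace_lim (R : realType) (g_ : nat -> R -> R) (g : R -> R) (C : R) :
  (forall n, is_laplace (g_ n)) ->
  (forall x, 0 < x -> g_ n x @[n --> \oo] --> g x) ->
  (forall x, 0 < x -> 1 - C * x <= g x) -> is_laplace g.
Proof.
move=> /choice[lam Hlam] gcvg glb.
have hlam n : on_half_line (lam n) := (Hlam n).1.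
have elam n x : 0 < x -> laplace (lam n) x = g_ n x := (Hlam n).2 x.
have [G [UG GF]] := ultraFilterLemma (eventually_filter : ProperFilter \oo).
have PG : ProperFilter G by exact: ultra_proper.
have gG x : 0 < x -> g_ n x @[n --> G] --> g x.
  by move=> x0 U /(gcvg x x0) /=; exact: GF.
have /choice[f Hf] : forall t : R, exists l : R, cdfR (lam n) t @[n --> G] --> l.
  move=> t; apply: (ultralimit_itv01 UG) => n.
  by rewrite cdfR_ge0 cdfR_le1.
have f_nd : {homo f : s t / s <= t}.
  move=> s t st; apply: (ler_cvg_to (Hf s) (Hf t)).
  by apply: filterE => n; exact: cdfR_homo.
have f_ge0 t : 0 <= f t.
  by apply: (cvgr_to_ge (Hf t)); apply: filterE => n; exact: cdfR_ge0.
have f_le1 t : f t <= 1.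
  by apply: (cvgr_to_le (Hf t)); apply: filterE => n; exact: cdfR_le1.
have f_lt0 t : t < 0 -> f t = 0.
  move=> t0; apply/eqP; rewrite eq_le f_ge0 andbT.
  by apply: (cvgr_to_le (Hf t)); apply: filterE => n; rewrite cdfR_lt0.
have f_step_le x delta K q : 0 < x -> 0 < delta -> q = expR (- (x * delta)) ->
    \sum_(k < K) (q ^+ k - q ^+ k.+1) * f (k%:R * delta) <= g x.
  move=> x0 d0 qE.
  have cS : \sum_(k < K) (q ^+ k - q ^+ k.+1) * cdfR (lam n) (k%:R * delta)
      @[n --> G] --> \sum_(k < K) (q ^+ k - q ^+ k.+1) * f (k%:R * delta).
    apply: cvg_big; [exact: add_continuous|move=> k _].
    by apply: cvgMl_tmp; exact: Hf.
  apply: (ler_cvg_to cS (gG x x0) _); apply: filterE => n.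
  by rewrite -elam// qE; exact: laplace_ge_step.
have f_step_ge x delta K q : 0 < x -> 0 < delta -> q = expR (- (x * delta)) ->
    g x <= \sum_(k < K) (q ^+ k - q ^+ k.+1) * f (k.+1%:R * delta) + q ^+ K.
  move=> x0 d0 qE.
  have cS : \sum_(k < K) (q ^+ k - q ^+ k.+1) * cdfR (lam n) (k.+1%:R * delta)
        + q ^+ K @[n --> G] -->
      \sum_(k < K) (q ^+ k - q ^+ k.+1) * f (k.+1%:R * delta) + q ^+ K.
    apply: cvgD; last exact: cvg_cst.
    apply: cvg_big; [exact: add_continuous|move=> k _].
    by apply: cvgMl_tmp; exact: Hf.
  apply: (ler_cvg_to (gG x x0) cS _); apply: filterE => n.
  by rewrite -elam// qE; exact: laplace_le_step.
(* Tightness. The upper sum with a single cell of width [x^-1] reads [g x <= (1 - q) * f (x^-1) + q]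
   with [q = expR (- 1)]; against [1 - C * x <= g x] it bounds [f (x^-1)] below, and [x] is chosen
   to make the loss at most [e]. *)
have f_y e : 0 < e -> exists t, 1 - e <= f t.
  move=> e0; pose q : R := expR (- 1).
  have q1 : q < 1 by rewrite expR_lt1 oppr_lt0.
  have q0 : 0 < 1 - q by rewrite subr_gt0.
  pose x := (1 - q) * e / (`|C| + 1).
  have C0 : 0 < `|C| + 1 by rewrite ltr_wpDl.
  have x0 : 0 < x by rewrite !mulr_gt0 ?invr_gt0.
  exists x^-1.
  have := f_step_ge x x^-1 1%N q x0; rewrite invr_gt0 mulfV ?gt_eqF//.
  move=> /(_ x0 erefl); rewrite big_ord1 expr0 expr1 mul1r => h.
  have hC : C * x <= (1 - q) * e.
    rewrite /x mulrCA -[leRHS]mulr1 ler_pM2l ?mulr_gt0//.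
    rewrite ler_pdivrMr// mul1r.
    by rewrite (le_trans (ler_norm C))// lerDl.
  have h2 := le_trans (glb x x0) h.
  rewrite -(ler_pM2l q0).
  by nra.
have [P [hP eP]] := rreg_probability f_nd f_ge0 f_le1 f_lt0 f_y.
exists P; split => // x x0.
have q0 delta : 0 < expR (- (x * delta)) by exact: expR_gt0.
have c0 delta k : 0 < delta ->
    0 <= expR (- (x * delta)) ^+ k - expR (- (x * delta)) ^+ k.+1.
  move=> d0; rewrite exprS -{1}[_ ^+ k]mul1r -mulrBl mulr_ge0 ?exprn_ge0 ?(ltW (q0 _))//.
  by rewrite subr_ge0 -expR0 ler_expR oppr_le0 mulr_ge0// ltW.
pose d n : R := n.+1%:R^-1.
have d0 n : 0 < d n by rewrite invr_gt0.
(* With mesh [1/(n+1)], this many cells reach the horizon [n+1]: the mesh vanishes and the remainder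
   [q n ^+ K n] tends to zero together. *)
pose K n := (n.+1 * n.+1)%N.
pose q n := expR (- (x * d n)).
have qK n : q n ^+ K n = expR (- (x * n.+1%:R)).
  rewrite /q /K -expRM_natr mulNr natrM /d; congr (expR (- _)).
  by rewrite -mulrA mulKf ?pnatr_eq0.
have cq : q n @[n --> \oo] --> (1 : R) by exact: cvg_expR_inv.
have cqK : q n ^+ K n @[n --> \oo] --> (0 : R).
  by under eq_cvg do rewrite qK; exact: cvg_expR_oppMn.
(* Shifting the index of the drops by two multiplies them by [q ^+ 2]: one shift turns an upper sum
   into a lower one, the other pays for replacing the regularization by [f]. The reverse bound [lo]
   needs only one shift, and [q n] tends to 1. *)
have up n : q n ^+ 2 * (laplace P x - q n ^+ K n) <= g x.
  have h1 := @laplace_le_step R x (d n) x0 (d0 n) P (K n) hP.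
  have h2 := f_step_le x (d n) (K n).+2 (q n) x0 (d0 n) erefl.
  apply: le_trans h2; rewrite 2!big_ord_recl/= addrA ler_wpDl//.
    by rewrite addr_ge0// mulr_ge0//; exact: c0.
  rewrite -lerBlDr in h1.
  apply: le_trans (_ : q n ^+ 2 * \sum_(k < K n)
    (q n ^+ k - q n ^+ k.+1) * cdfR P (k.+1%:R * d n) <= _).
    by rewrite ler_wpM2l// exprn_ge0// ltW// q0.
  rewrite mulr_sumr; apply: ler_sum => k _; rewrite /bump/= !add1n.
  rewrite mulrA mulrBr -!exprD !add2n ler_wpM2l//; first exact: c0.
  rewrite eP ?mulr_ge0//; last exact/ltW/d0.
  by apply: rreg_le => //; rewrite ltr_pM2r// ltr_nat.
have lo n : q n * (g x - q n ^+ K n) <= laplace P x.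
  have h1 := @laplace_ge_step R x (d n) x0 (d0 n) P (K n).+1 hP.
  have h2 := f_step_ge x (d n) (K n) (q n) x0 (d0 n) erefl.
  apply: le_trans h1; rewrite big_ord_recl/= ler_wpDl//.
    by rewrite mulr_ge0// ?cdfR_ge0//; exact: c0.
  rewrite -lerBlDr in h2.
  apply: le_trans (_ : q n * \sum_(k < K n)
    (q n ^+ k - q n ^+ k.+1) * f (k.+1%:R * d n) <= _).
    by rewrite ler_wpM2l// ltW// q0.
  rewrite mulr_sumr; apply: ler_sum => k _; rewrite /bump/= !add1n.
  rewrite mulrA mulrBr -!exprS ler_wpM2l//; first exact: c0.
  rewrite eP ?mulr_ge0//; last exact/ltW/d0.
  exact: le_rreg.
apply/eqP; rewrite eq_le; apply/andP; split.
  have -> : laplace P x = 1 ^+ 2 * (laplace P x - 0) by rewrite expr1n mul1r subr0.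
  have cu : q n ^+ 2 * (laplace P x - q n ^+ K n) @[n --> \oo] -->
      1 ^+ 2 * (laplace P x - 0).
    apply: cvgM; last by apply: cvgB => //; exact: cvg_cst.
    by under eq_cvg do rewrite expr2; rewrite expr2; exact: cvgM.
  by apply: (cvgr_to_le cu); exact: nearW.
have -> : g x = 1 * (g x - 0) by rewrite mul1r subr0.
have cl : q n * (g x - q n ^+ K n) @[n --> \oo] --> 1 * (g x - 0).
  by apply: cvgM => //; apply: cvgB => //; exact: cvg_cst.
by apply: (cvgr_to_le cl); exact: nearW.
Qed.

(** * Continuants and skew-symmetric path matrices *)

(* Diagonalising the Hermitian matrix ['i *: S] turns [1 + t *: S] into
   [1 - 'i t d]; averaging with the conjugate leaves [1 + t^2 d^2]. *)
Lemma skew_resolvent (C : numClosedFieldType) (n : nat) (S : 'M[C]_n) :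
  (forall i j, S i j \is Num.real) -> S^T = - S ->
  exists (P : 'M[C]_n) (d : 'I_n -> C), (forall k, d k \is Num.real) /\
  forall (t : C) (u v : 'cV[C]_n), t \is Num.real ->
    (forall i, u i 0 \is Num.real) -> (forall i, v i 0 \is Num.real) ->
    v + t *: (S *m v) = u ->
    (u^T *m v) 0 0 = \sum_k `|(P *m u) k 0| ^+ 2 / (1 + t ^+ 2 * d k ^+ 2).
Proof.
move=> rS skS.
pose H : 'M[C]_n := 'i *: S.
have hH : H \is hermsymmx.
  rewrite is_hermitianmxE expr0 scale1r; apply/eqP/matrixP => i j.
  rewrite !mxE rmorphM/= conjCi (CrealP (rS j i)).
  by have /matrixP/(_ i j) := skS; rewrite !mxE => ->; rewrite mulrNN.
have nH := hermitian_normalmx hH.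
have dH := hermitian_spectral_diag_real hH.
have HE := orthomx_spectralP nH.
set P := spectralmx H in HE.
set D := spectral_diag H in HE dH.
have uP : P \is unitarymx by exact: spectral_unitarymx.
have PV := invmx_unitary uP.
have Pu : P \in unitmx by exact: unitarymx_unit.
have dr k : D 0 k \is Num.real by exact: (mxOverP dH).
exists P, (fun k => D 0 k); split => // t u v rt ru rv uv.
have SE : S = - ('i *: H) by rewrite scalerA -expr2 sqrCi scaleN1r opprK.
have PH : P *m H = diag_mx D *m P by rewrite HE -!mulmxA mulKVmx.
have key k : (1 - 'i * t * D 0 k) * (P *m v) k 0 = (P *m u) k 0.
  rewrite -uv mulmxDr -scalemxAr SE mulNmx mulmxN -scalemxAl -scalemxAr.
  rewrite mulmxA PH -mulmxA mul_diag_mx !mxE.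
  by ring.
have nz2 k : 1 + t ^+ 2 * D 0 k ^+ 2 != 0.
  by rewrite gt_eqF// -exprMn ltr_pwDl// real_exprn_even_ge0// rpredM.
have nz k : 1 - 'i * t * D 0 k != 0.
  apply: contra_neq (nz2 k) => h.
  have -> : 1 + t ^+ 2 * D 0 k ^+ 2 = (1 - 'i * t * D 0 k) * (1 + 'i * t * D 0 k).
    rewrite -subr_sqr expr1n !exprMn sqrCi; ring.
  by rewrite h mul0r.
have nz' k : 1 + 'i * t * D 0 k != 0.
  apply: contra_neq (nz2 k) => h.
  have -> : 1 + t ^+ 2 * D 0 k ^+ 2 = (1 - 'i * t * D 0 k) * (1 + 'i * t * D 0 k).
    rewrite -subr_sqr expr1n !exprMn sqrCi; ring.
  by rewrite h mulr0.
have uvE : (u^T *m v) 0 0 = \sum_k `|(P *m u) k 0| ^+ 2 / (1 - 'i * t * D 0 k).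
  have -> : u^T *m v = (u^T *m invmx P) *m (P *m v) by rewrite -mulmxA mulKmx.
  rewrite mxE; apply: eq_bigr => k _.
  have -> : (P *m v) k 0 = (P *m u) k 0 / (1 - 'i * t * D 0 k).
    by rewrite -key mulrC mulKf.
  rewrite mulrA normCKC; congr (_ * _ / _); rewrite PV !mxE rmorph_sum.
  by apply: eq_bigr => j _; rewrite !mxE rmorphM/= (CrealP (ru j)) mulrC.
have uvr : (u^T *m v) 0 0 \is Num.real.
  by rewrite mxE rpred_sum// => j _; rewrite mxE rpredM.
have uvE' : (u^T *m v) 0 0 = \sum_k `|(P *m u) k 0| ^+ 2 / (1 + 'i * t * D 0 k).
  rewrite -(CrealP uvr) uvE rmorph_sum; apply: eq_bigr => k _.
  rewrite rmorphM rmorphXn/= (CrealP (normr_real _)); congr (_ * _).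
  rewrite fmorphV rmorphB rmorph1 !rmorphM/= conjCi (CrealP rt) (CrealP (dr k)).
  by rewrite !mulNr opprK.
apply: (@mulfI _ 2%:R); first by rewrite pnatr_eq0.
rewrite {1}mulr2n mulrDl !mul1r {1}uvE uvE' -big_split mulr_sumr.
apply: eq_bigr => k _ /=.
have -> : 1 + t ^+ 2 * D 0 k ^+ 2 = (1 - 'i * t * D 0 k) * (1 + 'i * t * D 0 k).
  rewrite -subr_sqr expr1n !exprMn sqrCi; ring.
by field; rewrite nz nz'.
Qed.

(** Expansion at the first vertex of the path, which is either free or matched with the second
    one. *)
Fixpoint continuant (R : pzSemiRingType) (y : R) (l : seq R) : R :=
  if l is e1 :: l1 then
    continuant y l1 + (if l1 is e2 :: l2 then y * e1 * e2 * continuant y l2 else 0)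
  else 1.

(** The default value [0] of [nth] makes the recurrence valid at the last letter and beyond the end
    as well. *)
Lemma continuant_drop (R : pzSemiRingType) (y : R) (l : seq R) (i : nat) :
  continuant y (drop i l) = continuant y (drop i.+1 l)
    + y * l`_i * l`_i.+1 * continuant y (drop i.+2 l).
Proof.
elim: l i => [|e l IH] [|i] /=; rewrite ?mulr0 ?mul0r ?addr0//.
  by case: l IH => [|e2 l] IH /=; rewrite ?drop0// mulr0 mul0r.
Qed.

Lemma continuant_ge1 (R : numDomainType) (y : R) (l : seq R) : 0 <= y ->
  all (fun e => 0 <= e) l -> 1 <= continuant y l.
Proof.
move=> y0; have [m] := ubnP (size l); elim: m l => // m IH [|e1 [|e2 l]] //=.
  by rewrite addr0.
rewrite !ltnS => sl /and3P[e1_0 e2_0 l0].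
have h1 : 1 <= continuant y (e2 :: l) by apply: IH => //=; rewrite e2_0.
have h2 : 1 <= continuant y l by apply: IH => //; exact: ltnW.
by rewrite (le_trans h1)// lerDl !mulr_ge0// (le_trans ler01).
Qed.

(* [t^j sqrt(e_0 e_1) ... sqrt(e_(j-1) e_j) K_(j+1) / K_0] solves the
   tridiagonal system [v + t S v = delta_0] because of [continuant_drop]. *)
Lemma continuant_ratio (R : realType) (e0 : R) (l : seq R) :
  all (fun e => 0 <= e) (e0 :: l) ->
  exists (n : nat) (w b : 'I_n -> R),
    [/\ forall k, 0 <= w k, forall k, 0 <= b k &
     forall y, 0 <= y -> continuant y l / continuant y (e0 :: l) =
        \sum_k w k / (1 + b k * y)].
Proof.
move=> l0.
pose C : numClosedFieldType := complex.complex R.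
pose toC : {rmorphism R -> C} := complex.real_complex R.
have toC_real x : toC x \is Num.real by apply/complex_realP; exists x.
pose L := e0 :: l.
pose n := size L.
pose r i := Num.sqrt (L`_i * L`_i.+1).
have L_ge0 i : 0 <= L`_i.
  have [iL|iL] := ltnP i (size L); last by rewrite nth_default.
  by apply: (allP l0); rewrite mem_nth.
have r2 i : r i ^+ 2 = L`_i * L`_i.+1 by rewrite sqr_sqrtr// mulr_ge0.
(* The last vertex has no successor: the default letter [0] makes the corresponding matrix entry
   vanish, so that the system has no special last equation. *)
have r_last i : (n <= i.+1)%N -> r i = 0.
  by move=> ni; rewrite /r (nth_default _ ni) mulr0 sqrtr0.
pose s (i j : nat) : R := (j == i.+1)%:R * r i - (i == j.+1)%:R * r j.
pose S : 'M[C]_n := \matrix_(i, j) toC (s i j).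
have [||P [d [dr PdE]]] := @skew_resolvent C n S.
- by move=> i j; rewrite mxE.
- apply/matrixP => i j; rewrite !mxE -rmorphN; congr (toC _).
  by rewrite /s opprB.
pose i0 : 'I_n := ord0.
pose u : 'cV[C]_n := delta_mx i0 0.
have toC_le x : (0 <= toC x) = (0 <= x) by exact: lecR.
have realE (f : 'I_n -> C) : (forall k, f k \is Num.real) ->
    exists g : 'I_n -> R, forall k, toC (g k) = f k.
  by move=> rf; exists (fun k => complex.Re (f k)) => k; exact: RRe_real.
have [k|w wE] := realE (fun k => `|(P *m u) k 0| ^+ 2).
  by rewrite rpredX// normr_real.
have [k|b bE] := realE (fun k => d k ^+ 2); first by rewrite rpredX.
exists n, w, b; split.
- by move=> k; rewrite -toC_le wE exprn_ge0.
- by move=> k; rewrite -toC_le bE real_exprn_even_ge0.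
move=> y y0.
pose K i := continuant y (drop i L).
have K_gt0 i : 0 < K i.
  rewrite (lt_le_trans ltr01)// continuant_ge1//; apply/allP => e /mem_drop.
  exact: (allP l0).
have KE i : K i = K i.+1 + y * r i ^+ 2 * K i.+2.
  by rewrite /K continuant_drop r2 mulrA.
pose t := Num.sqrt y.
have t2 : t ^+ 2 = y by rewrite sqr_sqrtr.
pose v j : R := (\prod_(i < j) (t * r i)) * K j.+1 / K 0%N.
pose V : 'cV[C]_n := \col_j toC (v j).
have sel (m : nat) (F : nat -> R) :
    \sum_(j < n) (j == m :> nat)%:R * F j = if (m < n)%N then F m else 0.
  rewrite -(@big_ord1_eq R 0 +%R F) [RHS]big_mkcond; apply: eq_bigr => j _.
  by case: eqP; rewrite ?mul1r ?mul0r.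
have SV (i : nat) : \sum_(j < n) s i j * v j =
    r i * v i.+1 - (if i is j.+1 then (if (j < n)%N then r j * v j else 0) else 0).
  under eq_bigr do rewrite /s mulrBl -!mulrA.
  rewrite sumrB (sel i.+1 (fun j => r i * v j)); congr (_ - _).
    by case: ltnP => // ni; rewrite r_last// mul0r.
  case: i => [|i]; first by rewrite big1// => j _; rewrite mul0r.
  rewrite -(sel i (fun j => r j * v j)); apply: eq_bigr => j _.
  by rewrite eqSS eq_sym.
have vE (i : nat) : (i < n)%N -> v i + t * \sum_(j < n) s i j * v j = (i == 0%N)%:R.
  have vS k : v k + t * (r k * v k.+1) = (\prod_(j < k) (t * r j)) * K k / K 0%N.
    rewrite /v big_ord_recr/= (KE k) -t2; ring.
  move=> ni; rewrite SV mulrBr addrA vS; case: i ni => [|i] ni.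
    by rewrite big_ord0 mul1r mulfV ?(lt0r_neq0 (K_gt0 _))//= mulr0 subr0.
  by rewrite (ltnW ni) big_ord_recr/= /v; ring.
have uE (i : 'I_n) : V i 0 + (toC t *: (S *m V)) i 0 = u i 0.
  rewrite !mxE; under eq_bigr do rewrite !mxE -rmorphM.
  rewrite -rmorph_sum -rmorphM -rmorphD vE// andbT.
  by rewrite rmorph_nat.
have VE : V + toC t *: (S *m V) = u.
  by apply/matrixP => i j; rewrite ord1 -uE mxE.
have ru i : u i 0 \is Num.real by rewrite mxE andbT rpred_nat.
have rV i : V i 0 \is Num.real by rewrite mxE.
have := PdE (toC t) u V (toC_real t) ru rV VE.
have -> : (u^T *m V) 0 0 = toC (v 0%N).
  rewrite mxE (bigD1 i0)//= big1 => [|j /negbTE ji]; rewrite !mxE ?ji ?mul0r//.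
  by rewrite eqxx mul1r addr0.
move=> vE0; apply: (@complexI R).
have -> : continuant y l / continuant y (e0 :: l) = v 0%N.
  by rewrite /v big_ord0 mul1r /K/= drop0.
apply: etrans vE0 _; rewrite rmorph_sum; apply: eq_bigr => k _.
by rewrite fmorph_div rmorphD rmorph1 rmorphM -wE -bE -rmorphXn t2 (mulrC (toC y)).
Qed.

(** * Infinitely divisible laws from quotients of continuants *)

Lemma laplace_itv01 (R : realType) (g : R -> R) (x : R) : is_laplace g -> 0 < x ->
  0 <= g x <= 1.
Proof.
move=> [l [h e]] x0; rewrite -e// -!lee_fin laplaceE ?(ltW x0)//.
have h0 : (0 <= \int[l]_(t in `[0%R, +oo[) (expR (- (x * t)))%:E)%E.
  by apply: integral_ge0 => t _; rewrite lee_fin expR_ge0.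
apply/andP; split; first exact: h0.
apply: (@le_trans _ _ (\int[l]_(t in `[0%R, +oo[) (cst 1%E t))%E); last first.
  by rewrite integral_cst//= mul1e h.
apply: ge0_le_integral => //.
- exact: measurable_expRM.
- move=> t; rewrite /= in_itv/= andbT => t0; rewrite lee_fin -expR0 ler_expR.
  by rewrite oppr_le0 mulr_ge0// ltW.
Qed.

Lemma is_laplace_inv (R : realType) (b : R) : 0 <= b ->
  is_laplace (fun x => (1 + b * x)^-1).
Proof.
rewrite le_eqVlt => /predU1P[<-|b0].
  apply: is_laplace_ext (is_laplace1 R) => x x0.
  by rewrite mul0r addr0 invr1.
by have [P [h e _]] := exponential_law b0; exists P.
Qed.

Lemma is_laplace_prod (R : realType) (N : nat) (f : nat -> R -> R) :
  (forall i, is_laplace (f i)) -> is_laplace (fun x => \prod_(i < N) f i x).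
Proof.
move=> Lf; elim: N => [|N IH].
  by apply: is_laplace_ext (is_laplace1 R) => x _; rewrite big_ord0.
by apply: is_laplace_ext (is_laplaceM IH (Lf N)) => x _; rewrite big_ord_recr.
Qed.

(* The transform [h] of a compound geometric law solves [g = p + (1 - p) h g]. *)
Lemma is_laplace_geometric (R : realType) (h : R -> R) (W C : R) : 0 <= W ->
  is_laplace h -> (forall x, 0 < x -> 1 - C * x <= h x) ->
  is_laplace (fun x => (1 + W * (1 - h x))^-1).
Proof.
move=> W0 Lh hC.
have W1 : 0 < 1 + W by rewrite ltr_wpDr.
pose p := (1 + W)^-1.
have p0 : 0 < p by rewrite invr_gt0.
have p1 : p <= 1 by rewrite invf_le1// lerDl.
(* The [n]-th iterate is the transform of the geometric sum stopped after [n] terms; the fixed-point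
   map contracts by [1 - p], which gives the convergence. *)
pose g_ n := iter n (fun g x => p * 1 + (1 - p) * (h x * g x)) (fun=> 1).
have Lg n : is_laplace (g_ n).
  elim: n => [|n IH]; first exact: is_laplace1.
  apply: is_laplace_mix => //; [exact: ltW|exact: is_laplace1|exact: is_laplaceM].
apply: (is_laplace_lim (g_ := g_) (C := W * C)) => // x x0;
  have /andP[h0 h1] := laplace_itv01 Lh x0.
- pose g := (1 + W * (1 - h x))^-1.
  have D0 : 0 < 1 + W * (1 - h x).
    by rewrite ltr_pwDl// mulr_ge0// subr_ge0.
  have gE : g = p + (1 - p) * (h x * g).
    by rewrite /g /p; field; rewrite !gt_eqF.
  have dist n : `|g - g_ n x| <= (1 - p) ^+ n * `|g - 1|.
    elim: n => [|n IH]; first by rewrite expr0 mul1r.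
    rewrite /g_ iterS -/(g_ n) {1}gE mulr1 opprD addrACA subrr add0r -mulrBr -mulrBr.
    rewrite !normrM (ger0_norm h0) ger0_norm ?subr_ge0// exprS -mulrA.
    rewrite ler_wpM2l ?subr_ge0// (le_trans _ IH)// ler_piMl//.
  have : (1 - p) ^+ n * `|g - 1| @[n --> \oo] --> (0 : R).
    rewrite -[X in _ --> X](mul0r `|g - 1|); apply: cvgMr_tmp; apply: cvg_expr.
    by rewrite ger0_norm ?subr_ge0// ltrBlDr ltrDl.
  move=> c0; apply/cvgrPdist_le => e e0.
  have /cvgrPdist_le/(_ _ e0) := c0; apply: filterS => n.
  rewrite sub0r normrN ger0_norm; first exact: le_trans.
  by rewrite mulr_ge0// exprn_ge0// subr_ge0.
- have D0 : 0 <= W * (1 - h x) by rewrite mulr_ge0// subr_ge0.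
  rewrite (@le_trans _ _ (1 - W * (1 - h x)))//.
    by rewrite lerD2l lerN2 -mulrA ler_wpM2l// lerBlDl -lerBlDr hC.
  move: D0; set v := W * _ => v0.
  by rewrite -[leRHS]div1r ler_pdivlMr ?ltr_pwDl//; nra.
Qed.

Lemma is_laplace_sum (R : realType) (s : seq (R * R)) :
  (forall p, p \in s -> 0 <= p.1 /\ 0 <= p.2) -> 0 < \sum_(p <- s) p.1 ->
  is_laplace (fun x =>
    (\sum_(p <- s) p.1 / (1 + p.2 * x)) / \sum_(p <- s) p.1).
Proof.
elim: s => [|[w b] s IH] s0; first by rewrite big_nil ltxx.
have [/= w0 b0] := s0 (w, b) (mem_head _ _).
have {}s0 p : p \in s -> 0 <= p.1 /\ 0 <= p.2.
  by move=> ps; apply: s0; rewrite in_cons ps orbT.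
have S0 : 0 <= \sum_(p <- s) p.1 by rewrite big_seq sumr_ge0// => p /s0[].
rewrite !big_cons/=.
move: S0; rewrite le_eqVlt => /predU1P[S0|S0 wS0].
  rewrite -S0 addr0 => w_gt0.
  apply: is_laplace_ext (is_laplace_inv b0) => x x0.
  rewrite big_cons/= big_seq big1 ?addr0; last first.
    move=> p ps; suff -> : p.1 = 0 by rewrite mul0r.
    apply/eqP; have /eqP := esym S0; rewrite big_seq psumr_eq0 => [|q /s0[]//].
    by move=> /allP/(_ p ps)/implyP/(_ ps).
  by rewrite mulrAC mulfV ?gt_eqF// mul1r.
have Lm := @is_laplace_mix _ (w / (w + \sum_(p <- s) p.1)) _ _ _ _
  (is_laplace_inv b0) (IH s0 S0).
apply: is_laplace_ext (Lm _ _) => [x x0||].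
- rewrite big_cons/=.
  by field; rewrite !gt_eqF// ltr_pwDl// mulr_ge0// ltW.
- by rewrite divr_ge0// ltW.
- by rewrite ler_pdivrMr// mul1r lerDl ltW.
Qed.

(** A complete Bernstein function with finitely many atoms: a pair stands for the coefficients
    [(c, d)] of [c x / (1 + d x)], and [d = 0] is allowed for linear terms. *)
Definition stieltjes_sum (R : realType) (s : seq (R * R)) (x : R) : R :=
  \sum_(p <- s) p.1 * x / (1 + p.2 * x).

Lemma stieltjes_sum_ge0 (R : realType) (s : seq (R * R)) (x : R) :
  (forall p, p \in s -> 0 <= p.1 /\ 0 <= p.2) -> 0 <= x ->
  0 <= stieltjes_sum s x.
Proof.
move=> s0 x0; rewrite /stieltjes_sum big_seq sumr_ge0// => p /s0[p1 p2].
by rewrite divr_ge0// ?mulr_ge0// ltW// ltr_pwDl// mulr_ge0.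
Qed.

Lemma stieltjes_sum_le (R : realType) (s : seq (R * R)) (x : R) :
  (forall p, p \in s -> 0 <= p.1 /\ 0 <= p.2) -> 0 <= x ->
  stieltjes_sum s x <= (\sum_(p <- s) p.1) * x.
Proof.
move=> s0 x0; rewrite /stieltjes_sum mulr_suml big_seq [leRHS]big_seq.
apply: ler_sum => p /s0[p1 p2].
rewrite ler_pdivrMr; last by rewrite ltr_pwDl// mulr_ge0.
by rewrite mulrDr mulr1 lerDl !mulr_ge0.
Qed.

Lemma inv_1D_ge (R : realFieldType) (v : R) : 0 <= v -> 1 - v <= (1 + v)^-1.
Proof. by move=> v0; rewrite -[leRHS]div1r ler_pdivlMr ?ltr_pwDl//; nra. Qed.

(** For [d > 0], c x / (1 + d x) = (c/d) (1 - 1/(1 + d x)). Hence the sum is [W * (1 - h x)], where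
    [h] is the transform of a mixture of exponential laws and [W] is the total of the c/d, and the
    compound geometric law applies. *)
Lemma is_laplace_stieltjes_pos (R : realType) (s : seq (R * R)) (u : R) :
  (forall p, p \in s -> 0 <= p.1 /\ 0 < p.2) -> 0 <= u ->
  is_laplace (fun x => (1 + u * stieltjes_sum s x)^-1).
Proof.
move=> s0 u0.
pose s' := [seq (p.1 / p.2, p.2) | p <- s].
have s'0 p : p \in s' -> 0 <= p.1 /\ 0 <= p.2.
  by move=> /mapP[q /s0[q1 q2] ->]/=; split; rewrite ?divr_ge0// ltW.
pose W := \sum_(p <- s') p.1.
have : 0 <= W by rewrite /W big_seq sumr_ge0// => p /s'0[].
rewrite le_eqVlt => /predU1P[W0|W0].
  apply: is_laplace_ext (is_laplace1 R) => x x0.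
  rewrite /stieltjes_sum big_seq big1 ?mulr0 ?addr0 ?invr1// => p ps.
  have [p1 p2] := s0 _ ps.
  suff -> : p.1 = 0 by rewrite !mul0r.
  have ps' : (p.1 / p.2, p.2) \in s' by apply/mapP; exists p.
  have /eqP := esym W0; rewrite /W big_seq psumr_eq0 => [|q /s'0[]//].
  move=> /allP/(_ _ ps')/implyP/(_ ps')/=.
  by rewrite mulf_eq0 invr_eq0 (gt_eqF p2) orbF => /eqP.
pose h x := (\sum_(p <- s') p.1 / (1 + p.2 * x)) / W.
have Lh : is_laplace h by exact: is_laplace_sum.
have hE x : 0 <= x -> W * (1 - h x) = stieltjes_sum s x.
  move=> x0; have -> : W * (1 - h x) = W - \sum_(p <- s') p.1 / (1 + p.2 * x).
    by rewrite mulrBr mulr1 /h [W * _]mulrC divfK ?gt_eqF.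
  rewrite /W !big_map -sumrB /stieltjes_sum big_seq [RHS]big_seq.
  apply: eq_bigr => p /s0[p1 p2]/=; field.
  by rewrite !gt_eqF// ltr_pwDl// mulr_ge0// ltW.
have s0' p : p \in s -> 0 <= p.1 /\ 0 <= p.2 by move=> /s0[? /ltW].
have hC x : 0 < x -> 1 - (\sum_(p <- s) p.1) / W * x <= h x.
  move=> x0; rewrite lerBlDl -lerBlDr mulrAC ler_pdivlMr// mulrC hE ?(ltW x0)//.
  exact: stieltjes_sum_le (ltW x0).
have := is_laplace_geometric (mulr_ge0 u0 (ltW W0)) Lh hC.
by apply: is_laplace_ext => x x0; rewrite -mulrA hE// ltW.
Qed.

(** Linear terms are reached by raising every [d] by [1/(n+1)] and letting [n] grow; the slope at 0,
    hence the constant [C], depends on the [c] alone. *)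
Lemma is_laplace_stieltjes (R : realType) (s : seq (R * R)) (u : R) :
  (forall p, p \in s -> 0 <= p.1 /\ 0 <= p.2) -> 0 <= u ->
  is_laplace (fun x => (1 + u * stieltjes_sum s x)^-1).
Proof.
move=> s0 u0.
pose s_ n := [seq (p.1, p.2 + n.+1%:R^-1 : R) | p <- s].
apply: (is_laplace_lim (g_ := fun n x => (1 + u * stieltjes_sum (s_ n) x)^-1)
  (C := u * \sum_(p <- s) p.1)) => [n|x x0|x x0].
- apply: is_laplace_stieltjes_pos => // _ /mapP[p /s0[p1 p2] ->]/=; split => //.
  by rewrite ltr_wpDl.
- apply: cvgV.
    by rewrite gt_eqF// ltr_pwDl// mulr_ge0// stieltjes_sum_ge0// ltW.
  apply: cvgD; first exact: cvg_cst.
  apply: cvgMl_tmp; rewrite /stieltjes_sum [X in _ --> X]big_seq.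
  under eq_cvg do rewrite big_map big_seq.
  apply: cvg_big; first exact: add_continuous.
  move=> p /s0[p1 p2]/=; apply: cvgMl_tmp; apply: cvgV.
    by rewrite gt_eqF// ltr_pwDl// mulr_ge0// ltW.
  apply: cvgD; first exact: cvg_cst.
  apply: cvgMr_tmp; rewrite -[X in _ --> X]addr0; apply: cvgD; first exact: cvg_cst.
  exact: cvg_harmonic.
- apply: le_trans (inv_1D_ge _); last first.
    by rewrite mulr_ge0// stieltjes_sum_ge0// ltW.
  by rewrite lerD2l lerN2 -mulrA ler_wpM2l// stieltjes_sum_le// ltW.
Qed.

Lemma is_laplace_ratio (R : realType) (s : seq (R * R)) (e' e : R) :
  (forall p, p \in s -> 0 <= p.1 /\ 0 <= p.2) -> 0 <= e' -> e' <= e ->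
  is_laplace (fun x => (1 + e' * stieltjes_sum s x) / (1 + e * stieltjes_sum s x)).
Proof.
move=> s0 e'0 e'e.
have := le_trans e'0 e'e; rewrite le_eqVlt => /predU1P[e0|e0].
  have -> : e' = 0 by apply: le_anti; rewrite e'0 e0 e'e.
  rewrite -e0; apply: is_laplace_ext (is_laplace1 R) => x _.
  by rewrite mul0r addr0 divr1.
(* The constant 1 has weight [e' / e] in the mixture, and the geometric transform the remaining
   weight. *)
have p0 : 0 <= e' / e by rewrite divr_ge0// ltW.
have p1 : e' / e <= 1 by rewrite ler_pdivrMr// mul1r.
have := is_laplace_mix p0 p1 (is_laplace1 R) (is_laplace_stieltjes s0 (ltW e0)).
apply: is_laplace_ext => x x0; field.
rewrite !gt_eqF// ltr_pwDl// mulr_ge0 ?(ltW e0)//.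
by rewrite stieltjes_sum_ge0// ltW.
Qed.

(* Comparison of the [m]-th power of one factor of the telescoping product with
   the product of [m] consecutive factors (Bernoulli's inequality). *)
Lemma telescope_block_le (R : realFieldType) (A d : R) (m : nat) : 0 < A -> 0 <= d ->
  (A / (A + d)) ^+ m <= A / (A + m%:R * d).
Proof.
move=> A0 d0.
have Ad : 0 < A + d by rewrite ltr_pwDl.
elim: m => [|m IH]; first by rewrite expr0 mul0r addr0 mulfV ?gt_eqF.
have md : 0 <= m%:R * d by rewrite mulr_ge0.
rewrite exprSr (le_trans (ler_wpM2r _ IH))//; first by rewrite divr_ge0 ?ltW.
have -> : m.+1%:R * d = m%:R * d + d by rewrite -natr1 mulrDl mul1r.
rewrite mulf_div.
rewrite ler_pdivrMr ?mulr_gt0 ?ltr_pwDl// mulrAC ler_pdivlMr; last first.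
  by rewrite addrA ltr_wpDr// ltr_pwDl.
move: (m%:R * d) md => z z0; have := mulr_ge0 (mulr_ge0 (ltW A0) z0) d0.
by nra.
Qed.

Lemma telescope_block_ge (R : realFieldType) (A d : R) (m : nat) : 0 < A -> 0 <= d ->
  A / (A + m%:R * d) <= ((A + m%:R * d) / (A + m%:R * d + d)) ^+ m.
Proof.
move=> A0 d0.
have md : 0 <= m%:R * d by rewrite mulr_ge0.
set B := A + m%:R * d + d.
have B0 : 0 < B by rewrite /B -addrA ltr_pwDl// addr_ge0.
have bern : 1 - m%:R * (d / B) <= ((A + m%:R * d) / B) ^+ m.
  have -> : (A + m%:R * d) / B = 1 - d / B.
    by rewrite /B; field; rewrite gt_eqF.
  have dB0 : 0 <= d / B by rewrite divr_ge0// ltW.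
  have dB : d / B <= 1.
    by rewrite ler_pdivrMr// mul1r /B lerDr addr_ge0// ltW.
  elim: (m) => [|k IH]; first by rewrite mul0r subr0 expr0.
  rewrite exprSr (le_trans _ (ler_wpM2r _ IH)) ?subr_ge0//.
  rewrite -natr1; have : 0 <= k%:R :> R by [].
  move: (k%:R) (d / B) dB0 => z v v0 z0.
  by have := mulr_ge0 z0 (mulr_ge0 v0 v0); nra.
apply: le_trans bern.
have -> : 1 - m%:R * (d / B) = (A + d) / B.
  by rewrite /B; field; rewrite gt_eqF.
rewrite ler_pdivrMr ?ltr_pwDl// mulrAC ler_pdivlMr// /B.
by move: (m%:R * d) md => z z0; have := mulr_ge0 z0 d0; nra.
Qed.

(** The full product of the factors z/(z+d), with z running in steps of [d], telescopes to
    [A 0 / A N]; here only the first factor of each block of [m] is kept. As z/(z+d) increases with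
    z, it is the smallest of its block, whence the upper bound. The first factor of the next block
    is larger than the whole block, whence the lower bound, where trading the last factor for the
    first one costs the extra power. *)
Lemma telescope_root_bounds (R : realFieldType) (A : nat -> R) (d : R) (m N : nat) :
  0 < A 0%N -> 0 <= d -> (forall i, A i.+1 = A i + m%:R * d) ->
  (A 0%N / A N) * (A 0%N / (A 0%N + d)) ^+ m
    <= (\prod_(i < N) (A i / (A i + d))) ^+ m <= A 0%N / A N.
Proof.
move=> A00 d0 AS.
have md : 0 <= m%:R * d by rewrite mulr_ge0.
have A_gt0 i : 0 < A i by elim: i => // i IH; rewrite AS ltr_pwDl.
pose q i := A i / (A i + d).
have Ad_gt0 i : 0 < A i + d by rewrite ltr_pwDl.
have q_ge0 i : 0 <= q i by rewrite divr_ge0 ?ltW.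
have q_le1 i : q i <= 1 by rewrite ler_pdivrMr// mul1r lerDl.
have up k : (\prod_(i < k) q i) ^+ m <= A 0%N / A k.
  elim: k => [|k IH]; first by rewrite big_ord0 expr1n mulfV ?gt_eqF.
  rewrite big_ord_recr/= exprMn.
  have -> : A 0%N / A k.+1 = (A 0%N / A k) * (A k / A k.+1).
    by rewrite mulrA divfK ?gt_eqF.
  apply: ler_pM => //; rewrite ?exprn_ge0 ?prodr_ge0//.
  by rewrite AS; exact: telescope_block_le.
have lo k : A 0%N / A k <= (\prod_(i < k) q i.+1) ^+ m.
  elim: k => [|k IH]; first by rewrite big_ord0 expr1n mulfV ?gt_eqF.
  rewrite big_ord_recr/= exprMn.
  have -> : A 0%N / A k.+1 = (A 0%N / A k) * (A k / A k.+1).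
    by rewrite mulrA divfK ?gt_eqF.
  have A_ge0 i : 0 <= A i by exact: ltW.
  apply: ler_pM; rewrite ?divr_ge0//.
  by rewrite /q AS; exact: telescope_block_ge.
rewrite up andbT -/(q 0%N) (le_trans (ler_wpM2r _ (lo N))) ?exprn_ge0//.
have P_ge0 (f : nat -> nat) : 0 <= \prod_(i < N) q (f i) by exact: prodr_ge0.
rewrite -exprMn; apply: lerXn2r; rewrite ?nnegrE.
- by apply: mulr_ge0; [exact: (P_ge0 succn)|exact: q_ge0].
- exact: (P_ge0 id).
have -> : \prod_(i < N) q i.+1 * q 0%N = \prod_(i < N) q i * q N.
  transitivity (\prod_(i < N.+1) q i); last by rewrite big_ord_recr.
  by rewrite big_ord_recl/= mulrC.
by rewrite ler_piMr// (P_ge0 id).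
Qed.

(** For nonnegative [g] the root is forced, so it is written as a real power: products and limits
    are then taken root by root, without choosing laws. *)
Definition is_id_laplace (R : realType) (g : R -> R) :=
  forall m : nat, (0 < m)%N -> is_laplace (fun x => g x `^ m%:R^-1).

Lemma cvg_root (R : realType) (r : nat -> R) (g : R) (m : nat) : (0 < m)%N ->
  0 < g -> (forall n, 0 <= r n) -> r n ^+ m @[n --> \oo] --> g ->
  r n @[n --> \oo] --> g `^ m%:R^-1.
Proof.
move=> m0 g0 r0 rg.
have -> : r = (fun n => (r n ^+ m) `^ m%:R^-1).
  apply/funext => n; rewrite -powR_mulrn// -powRrM mulfV ?powRr1//.
  by rewrite pnatr_eq0 -lt0n.
exact: (continuous_cvg _ (continuous_powR g0)).
Qed.

Lemma is_id_laplace_ratio (R : realType) (s : seq (R * R)) (e' e : R) :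
  (forall p, p \in s -> 0 <= p.1 /\ 0 <= p.2) -> 0 <= e' -> e' <= e ->
  is_id_laplace
    (fun x => (1 + e' * stieltjes_sum s x) / (1 + e * stieltjes_sum s x)).
Proof.
move=> s0 e'0 e'e m m0.
have e0 := le_trans e'0 e'e.
have mr0 : 0 < m%:R :> R by rewrite ltr0n.
(* The interval from [e'] to [e] is cut into [n.+1 * m] equal increments, and [r n] keeps one
   elementary ratio out of each block of [m]. *)
pose dl n : R := (e - e') / (n.+1%:R * m%:R).
have dl0 n : 0 <= dl n by rewrite divr_ge0 ?subr_ge0.
pose u n i := e' + i%:R * (m%:R * dl n).
have u0 n i : 0 <= u n i by rewrite addr_ge0// mulr_ge0// mulr_ge0// ltW.
pose r n (x : R) := \prod_(i < n.+1)
  ((1 + u n i * stieltjes_sum s x) / (1 + (u n i + dl n) * stieltjes_sum s x)).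
apply: (is_laplace_lim (g_ := r) (C := e * \sum_(p <- s) p.1)) => [n|x x0|x x0].
- apply: (is_laplace_prod n.+1 (f := fun i x =>
    (1 + u n i * stieltjes_sum s x) / (1 + (u n i + dl n) * stieltjes_sum s x))).
  by move=> i; apply: is_laplace_ratio => //; rewrite lerDl.
- have S0 := stieltjes_sum_ge0 s0 (ltW x0).
  set S := stieltjes_sum s x in S0 *.
  pose A0 := 1 + e' * S; pose g := A0 / (1 + e * S).
  have A0_gt0 : 0 < A0 by rewrite ltr_pwDl// mulr_ge0.
  have g0 : 0 < g by rewrite divr_gt0// ltr_pwDl// mulr_ge0.
  apply: cvg_root => // [n|].
    by apply: prodr_ge0 => i _; rewrite divr_ge0// addr_ge0// mulr_ge0// addr_ge0.
  have bnd n : g * (A0 / (A0 + dl n * S)) ^+ m <= r n x ^+ m <= g.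
    have dS : 0 <= dl n * S by rewrite mulr_ge0.
    have AE i : A0 + i%:R * (m%:R * (dl n * S)) = 1 + u n i * S.
      by rewrite /A0 /u; ring.
    have := @telescope_root_bounds R (fun i => A0 + i%:R * (m%:R * (dl n * S)))
      (dl n * S) m n.+1.
    rewrite mul0r addr0 => /(_ A0_gt0 dS) H; have {H} := H _.
    have -> : A0 + n.+1%:R * (m%:R * (dl n * S)) = 1 + e * S.
      by rewrite /A0 /dl; field; rewrite !gt_eqF.
    rewrite (_ : \prod_(i < n.+1) _ = r n x); last first.
      by apply: eq_bigr => i _; rewrite AE -/S; congr (_ / _); ring.
    by apply => i; rewrite -natr1; ring.
  apply: (squeeze_cvgr (f := fun n => g * (A0 / (A0 + dl n * S)) ^+ m) (h := fun=> g)).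
  + by apply: nearW.
  + rewrite [X in _ --> X](_ : g = g * (A0 / (A0 + 0 * S)) ^+ m); last first.
      by rewrite mul0r addr0 mulfV ?expr1n ?mulr1// gt_eqF.
    have cdl : dl n @[n --> \oo] --> (0 : R).
      rewrite /dl [X in _ --> X](_ : 0 = ((e - e') / m%:R) * 0); last by rewrite mulr0.
      under eq_cvg do rewrite invfM mulrCA mulrC.
      by apply: cvgMl_tmp; exact: cvg_harmonic.
    have cq : A0 / (A0 + dl n * S) @[n --> \oo] --> A0 / (A0 + 0 * S).
      apply: cvgMl_tmp; apply: cvgV; first by rewrite mul0r addr0 gt_eqF.
      by apply: cvgD; [exact: cvg_cst|exact: cvgMr_tmp].
    apply: cvgMl_tmp.
    have h := @exprn_continuous R m (A0 / (A0 + 0 * S)).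
    exact: (continuous_cvg _ h cq).
  + exact: cvg_cst.
- have S0 := stieltjes_sum_ge0 s0 (ltW x0).
  set S := stieltjes_sum s x in S0 *.
  have D0 : 0 < 1 + e * S by rewrite ltr_pwDl// mulr_ge0.
  have N0 : 0 < 1 + e' * S by rewrite ltr_pwDl// mulr_ge0.
  set g := _ / _.
  have g1 : g <= 1 by rewrite /g ler_pdivrMr// mul1r lerD2l ler_wpM2r.
  have g0 : 0 < g by rewrite divr_gt0.
  (* Since [0 < g <= 1], the root is at least [g], so a lower bound for [g] suffices. *)
  apply: (@le_trans _ _ g); last first.
    by rewrite ger1_powR ?g0// invf_le1// ler1n.
  apply: (@le_trans _ _ (1 + e * S)^-1); last first.
    by rewrite /g ler_peMl ?invr_ge0 ?(ltW D0)// lerDl mulr_ge0.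
  apply: le_trans (inv_1D_ge _); last by rewrite mulr_ge0.
  by rewrite lerD2l lerN2 -mulrA ler_wpM2l// stieltjes_sum_le// ltW.
Qed.

Lemma is_id_laplace_ext (R : realType) (f g : R -> R) :
  (forall x, 0 < x -> f x = g x) -> is_id_laplace f -> is_id_laplace g.
Proof.
by move=> fg If m m0; apply: is_laplace_ext (If m m0) => x x0; rewrite fg.
Qed.

Lemma is_id_laplaceM (R : realType) (f g : R -> R) :
  (forall x, 0 < x -> 0 <= f x) -> (forall x, 0 < x -> 0 <= g x) ->
  is_id_laplace f -> is_id_laplace g -> is_id_laplace (fun x => f x * g x).
Proof.
move=> f0 g0 If Ig m m0; apply: is_laplace_ext (is_laplaceM (If m m0) (Ig m m0)).
by move=> x x0; rewrite powRM// ?f0 ?g0.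
Qed.

Lemma is_id_laplaceW (R : realType) (g : R -> R) :
  (forall x, 0 < x -> 0 <= g x) -> is_id_laplace g -> is_laplace g.
Proof.
move=> g0 /(_ 1%N isT); apply: is_laplace_ext => x x0.
by rewrite invr1 powRr1// g0.
Qed.

Lemma is_id_laplace_lim (R : realType) (g_ : nat -> R -> R) (g : R -> R) (C : R) :
  (forall n, is_id_laplace (g_ n)) ->
  (forall x, 0 < x -> g_ n x @[n --> \oo] --> g x) ->
  (forall x, 0 < x -> 1 - C * x <= g x /\ 0 < g x <= 1) -> is_id_laplace g.
Proof.
move=> Ig gg gC m m0.
apply: (is_laplace_lim (g_ := fun n x => g_ n x `^ m%:R^-1) (C := C)) => [n|x x0|x x0].
- exact: Ig.
- have [_ /andP[gp _]] := gC x x0.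
  exact: (continuous_cvg _ (continuous_powR gp) (gg x x0)).
- have [gx g01] := gC x x0; apply: le_trans gx _.
  by rewrite ger1_powR// invf_le1 ?ler1n ?ltr0n.
Qed.

(** The matchings left when the first vertex is taken by a neighbour outside the word, its weight
    included and the factor [y] left out. *)
Definition continuant_head (R : pzSemiRingType) (y : R) (l : seq R) : R :=
  if l is e :: l1 then e * continuant y l1 else 0.

Lemma continuant_cons (R : comPzRingType) (y e : R) (l : seq R) :
  continuant y (e :: l) = continuant y l + y * e * continuant_head y l.
Proof. by case: l => [|e2 l] /=; rewrite ?mulr0 ?mulrA. Qed.

(** The word is split around the letter [e], with its left part stored in reverse, so that both
    neighbours of [e] are heads of lists. The vertex of [e] is free, or matched to the left, or
    matched to the right: the continuant is affine in [e]. *)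
Lemma continuant_catrev (R : comPzRingType) (y e : R) (l r : seq R) :
  continuant y (catrev l (e :: r)) =
    continuant y l * continuant y r
    + e * (y * (continuant_head y l * continuant y r
                + continuant y l * continuant_head y r)).
Proof.
elim: l e r => [|a l IH] e r.
  by rewrite [catrev _ _]/= continuant_cons /=; ring.
rewrite [catrev _ _]/= IH continuant_cons [continuant y (a :: l)]continuant_cons.
by rewrite /=; ring.
Qed.

Lemma continuant_head_ratio (R : realType) (l : seq R) :
  all (fun e => 0 <= e) l ->
  exists s : seq (R * R), (forall p, p \in s -> 0 <= p.1 /\ 0 <= p.2) /\
    forall y, 0 <= y ->
      y * continuant_head y l / continuant y l = stieltjes_sum s y.
Proof.
case: l => [_|a l al].
  by exists [::]; split => // y _; rewrite /stieltjes_sum big_nil /= mulr0 mul0r.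
have /andP[a0 _] := al.
have [n [w [b [w0 b0 ratio]]]] := continuant_ratio al.
exists [seq (a * w k, b k) | k <- enum 'I_n]; split.
  by move=> _ /mapP[k _ ->]/=; rewrite mulr_ge0.
move=> y y0; rewrite [continuant_head _ _]/= -!mulrA ratio//.
rewrite /stieltjes_sum big_map big_enum/= !mulr_sumr; apply: eq_bigr => k _.
by ring.
Qed.

Lemma is_id_laplace1 (R : realType) : is_id_laplace (fun _ : R => 1).
Proof.
by move=> m m0; apply: is_laplace_ext (is_laplace1 R) => x _; rewrite powR1.
Qed.

Lemma all_catrev (T : Type) (P : pred T) (l r : seq T) :
  all P (catrev l r) = all P l && all P r.
Proof. by elim: l r => //= a l IH r; rewrite IH /= andbCA andbA. Qed.

(** The first differing letter is changed from [e] to [e'] and then moved into [l], where the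
    induction on the rest of the word applies. Dividing by K(l) K(r), a continuant with letter [d]
    in that place becomes [1 + d * psi], where [psi] collects the left and right neighbours and does
    not depend on [d]. *)
Lemma is_id_continuant_ratio (R : realType) (l r' r : seq R) :
  all (fun e => 0 <= e) l -> all2 (fun e' e => 0 <= e' <= e) r' r ->
  is_id_laplace
    (fun x => continuant x (catrev l r') / continuant x (catrev l r)).
Proof.
have c0 (s : seq R) x : all (fun e => 0 <= e) s -> 0 < x -> 0 < continuant x s.
  by move=> s0 x0; rewrite (lt_le_trans ltr01)// continuant_ge1// ltW.
elim: r' r l => [|e' r' IH] [|e r] l //= l0.
  move=> _; apply: is_id_laplace_ext (is_id_laplace1 R) => x x0.
  by rewrite mulfV// gt_eqF// c0// all_catrev l0.
move=> /andP[/andP[e'0 e'e] r'r].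
have r0 : all (fun e => 0 <= e) r /\ all (fun e => 0 <= e) r'.
  elim: r' r r'r {IH} => [|a r' IH] [|b r]//= /andP[/andP[a0 ab] /IH[-> ->]].
  by rewrite a0 (le_trans a0 ab).
have e0 := le_trans e'0 e'e.
have I1 := IH r (e' :: l) (introT andP (conj e'0 l0)) r'r.
have [s1 [s10 s1E]] := continuant_head_ratio l0.
have [s2 [s20 s2E]] := continuant_head_ratio r0.1.
have s0 p : p \in s1 ++ s2 -> 0 <= p.1 /\ 0 <= p.2.
  by rewrite mem_cat => /orP[/s10|/s20].
have I2 := is_id_laplace_ratio s0 e'0 e'e.
have stepE x d : 0 < x -> continuant x (catrev l (d :: r)) =
    continuant x l * continuant x r * (1 + d * stieltjes_sum (s1 ++ s2) x).
  move=> x0; rewrite continuant_catrev /stieltjes_sum big_cat/=.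
  rewrite -!/(stieltjes_sum _ _) -s1E ?ltW// -s2E ?ltW//.
  by field; rewrite !gt_eqF ?c0 ?r0.1.
apply: is_id_laplace_ext (is_id_laplaceM _ _ I1 I2) => [x x0|x x0|x x0] /=.
- have cl := c0 l x l0 x0; have cr := c0 r x r0.1 x0.
  have S0 : 0 <= stieltjes_sum (s1 ++ s2) x by apply: stieltjes_sum_ge0 => //; exact: ltW.
  rewrite !stepE//; field.
  by rewrite !gt_eqF// ltr_pwDl// mulr_ge0.
- rewrite divr_ge0// ltW// c0// all_catrev /= e'0 l0/=; first exact: r0.2.
  exact: r0.1.
- have S0 : 0 <= stieltjes_sum (s1 ++ s2) x by apply: stieltjes_sum_ge0 => //; exact: ltW.
  by rewrite divr_ge0// addr_ge0// mulr_ge0.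
Qed.

(** * The gamma function and the Bessel series *)

Lemma powR_le_expR (R : realType) (p : R) : 0 <= p ->
  exists2 C : R, 0 < C & forall t, 0 < t -> t `^ p <= C * expR (t / 2).
Proof.
(* From ln u < u at u = t/c: p ln t <= p ln c + p t/c, and this [c] makes p/c at most 1/2. *)
move=> p0; pose c := 2 * (p + 1).
have c0 : 0 < c by rewrite mulr_gt0// ltr_wpDl.
exists (expR (p * ln c)); first exact: expR_gt0.
move=> t t0; rewrite /powR gt_eqF// -expRD ler_expR.
have -> : t = (t / c) * c by rewrite divfK ?gt_eqF.
have u0 : 0 < t / c by rewrite divr_gt0.
rewrite lnM ?posrE// mulrDr addrC lerD2l.
have h := ler_wpM2l p0 (ltW (ln_sublinear u0)).
apply: (le_trans h); rewrite /c mulrC.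
by move: (t / _) u0 => u u0; nra.
Qed.

(** Stated on compact intervals inside the open half line, away from the singularity at 0 that
    occurs when [z < 1]. *)
Lemma gamma_by_parts (R : realType) (z a b : R) : 0 < a -> a < b ->
  z * \int[lebesgue_measure]_(t in `[a, b]) (t `^ (z - 1) * expR (- t))
  = \int[lebesgue_measure]_(t in `[a, b]) (t `^ z * expR (- t))
    + (b `^ z * expR (- b) - a `^ z * expR (- a)).
Proof.
move=> a0 ab.
have cexp (x : R) : {for x, continuous (fun t : R => expR (- t))}.
  apply: continuous_comp; last exact: continuous_expR.
  exact: opp_continuous.
have cf p (x : R) : 0 < x -> {for x, continuous (fun t : R => t `^ p * expR (- t))}.
  by move=> x0; apply: continuousM; [exact: continuous_powR|exact: cexp].
have inab x : x \in `[a, b] -> 0 < x.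
  by rewrite in_itv/= => /andP[/(lt_le_trans a0)].
have wcf p : {within `[a, b], continuous (fun t : R => t `^ p * expR (- t))}.
  apply: continuous_in_subspaceT => x; rewrite inE => xab.
  by apply: cf; apply: inab.
have intf p : lebesgue_measure.-integrable `[a, b]
    (EFin \o (fun t : R => t `^ p * expR (- t))).
  by apply: continuous_compact_integrable; [exact: segment_compact|exact: wcf].
have dexp (x : R) : is_derive x 1 (fun t : R => expR (- t)) (- expR (- x)).
  by apply: is_derive_eq; rewrite mulrN mulr1.
have dF (x : R) : 0 < x -> is_derive x 1 (fun t : R => t `^ z * expR (- t))
    (z * (x `^ (z - 1) * expR (- x)) - x `^ z * expR (- x)).
  move=> x0; have dp := is_derive1_powR z x0.
  apply: is_derive_eq; rewrite /GRing.scale/=; ring.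
have FTC := @continuous_FTC2 R
  (fun x => z * (x `^ (z - 1) * expR (- x)) - x `^ z * expR (- x))
  (fun t => t `^ z * expR (- t)) a b ab.
have intG : (\int[lebesgue_measure]_(x in `[a, b])
    (z * (x `^ (z - 1) * expR (- x)) - x `^ z * expR (- x))%:E
    = (b `^ z * expR (- b))%:E - (a `^ z * expR (- a))%:E)%E.
  apply: FTC.
  - apply: continuous_in_subspaceT => x; rewrite inE => xab.
    have x0 := inab x xab.
    by apply: cvgB; [apply: cvgMl_tmp|]; exact: cf.
  - split.
    + by move=> x xab; have [] := dF x (inab x (subset_itv_oo_cc xab)).
    + by apply: cvg_at_right_filter; exact: cf.
    + by apply: cvg_at_left_filter; apply: cf; exact: lt_trans ab.
  - move=> x xab; have [_ e] := dF x (inab x (subset_itv_oo_cc xab)).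
    by rewrite derive1E e.
rewrite -RintegralZl//.
apply/eqP; rewrite [X in _ == X]addrC -subr_eq; apply/eqP.
rewrite -RintegralB//; first by rewrite /Rintegral intG.
apply: continuous_compact_integrable; first exact: segment_compact.
apply: continuous_in_subspaceT => x; rewrite inE => xab.
by apply: cvgMl_tmp; exact: cf (inab x xab).
Qed.

Lemma measurable_gamma_fun (R : realType) (p : R) (D : set R) :
  measurable_fun D (fun t : R => (t `^ p * expR (- t))%:E).
Proof.
apply/measurable_EFinP; apply: measurable_funTS; apply: measurable_funM.
  exact: measurable_powR.
by apply: measurableT_comp => //; exact: measurable_expR.
Qed.

(** The integrand is at most C exp(-t/2), that is [C * 2] times the exponential density of rate
    1/2. *)
Lemma gamma_lty_ge1 (R : realType) (p : R) : 0 <= p ->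
  (\int[lebesgue_measure]_(t in `]0%R, +oo[) (t `^ p * expR (- t))%:E < +oo)%E.
Proof.
move=> p0; have [C C0 hC] := powR_le_expR p0.
have h2 : 0 < 2^-1 :> R by [].
apply: (@le_lt_trans _ _ (\int[lebesgue_measure]_(t in `]0%R, +oo[)
   ((C * 2)%:E * (exponential_pdf 2^-1 t)%:E))%E).
  have mpdf : measurable_fun (`]0, +oo[%classic : set R) (fun t => (exponential_pdf 2^-1 t)%:E).
    by apply/measurable_EFinP; apply: measurable_funTS; exact: measurable_exponential_pdf.
  apply: ge0_le_integral => //.
  - by move=> t _; rewrite lee_fin mulr_ge0 ?powR_ge0 ?expR_ge0.
  - exact: measurable_gamma_fun.
  - exact: measurable_funeM.
  - move=> t; rewrite /= in_itv/= andbT => t0.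
    rewrite -EFinM lee_fin exponential_pdfE ?(ltW t0)// mulrA mulfK//.
    apply: (le_trans (ler_wpM2r (expR_ge0 _) (hC t t0))).
    rewrite -mulrA -expRD ler_wpM2l ?(ltW C0)// ler_expR.
    by rewrite (_ : t / 2 - t = - 2^-1 * t)//; field.
rewrite ge0_integralZl//; last 3 first.
- by apply/measurable_EFinP; apply: measurable_funTS; exact: measurable_exponential_pdf.
- by move=> t _; rewrite lee_fin exponential_pdf_ge0// ltW.
- by rewrite lee_fin mulr_ge0 ?(ltW C0).
apply: (@le_lt_trans _ _ ((C * 2)%:E * 1)%E); last by rewrite mule1 ltry.
apply: lee_wpmul2l; first by rewrite lee_fin mulr_ge0 ?(ltW C0).
rewrite -(integral_exponential_pdf h2); apply: ge0_subset_integral => //.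
- by apply/measurable_EFinP; exact: measurable_exponential_pdf.
- by move=> t _; rewrite lee_fin exponential_pdf_ge0// ltW.
Qed.

(** Monotone exhaustion of the half line. The offset 2 makes even the first interval nondegenerate,
    as integration by parts demands. *)
Lemma gamma_itv_cvg (R : realType) (p : R) :
  (\int[lebesgue_measure]_(t in `[(n.+2%:R^-1)%R, (n.+2%:R)%R]) (t `^ p * expR (- t))%:E
     @[n --> \oo] -->
   \int[lebesgue_measure]_(t in `]0%R, +oo[) (t `^ p * expR (- t))%:E)%E.
Proof.
have UE : `]0, +oo[%classic = \bigcup_n `[n.+2%:R^-1, n.+2%:R]%classic :> set R.
  apply/seteqP; split=> [t|t [n _]] /=; rewrite !in_itv/= andbT; last first.
    by move=> /andP[+ _]; apply: lt_le_trans.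
  move=> t0; exists (maxn (Num.bound t) (Num.bound t^-1)) => //=.
  have le_bound (u : R) k : 0 < u -> (Num.bound u <= k)%N -> u <= k.+2%:R.
    move=> u0 uk; apply: (le_trans (ltW (archi_boundP (ltW u0)))).
    by rewrite ler_nat (leq_trans uk)// !leqW.
  by rewrite in_itv/= invf_ple ?posrE// !le_bound ?leq_maxl ?leq_maxr ?invr_gt0.
rewrite UE; apply: ge0_nondecreasing_set_cvg_integral.
- move=> m n mn; apply/subsetPset => t; rewrite /= !in_itv/= => /andP[t1 t2].
  have mn2 : m.+2%:R <= n.+2%:R :> R by rewrite ler_nat !ltnS.
  rewrite (le_trans _ t1) ?(le_trans t2)//.
  by rewrite lef_pV2// posrE.
- by move=> n; exact: measurable_itv.
- by move=> n; exact: measurable_gamma_fun.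
- by move=> n t _; rewrite lee_fin mulr_ge0 ?powR_ge0 ?expR_ge0.
Qed.

Lemma gamma_boundary_cvg (R : realType) (z : R) : 0 < z ->
  (n.+2%:R `^ z * expR (- n.+2%:R) - n.+2%:R^-1 `^ z * expR (- n.+2%:R^-1))
    @[n --> \oo] --> (0 : R).
Proof.
move=> z0; rewrite -[X in _ --> X](subr0 0); apply: cvgB.
  have [C C0 hC] := powR_le_expR (ltW z0).
  have h2 : 0 < 2^-1 :> R by [].
  apply: (squeeze_cvgr (f := fun=> 0)
    (h := fun n => C * expR (- (2^-1 * n.+2%:R)))).
  - apply: nearW => n; rewrite mulr_ge0 ?powR_ge0 ?expR_ge0//=.
    apply: (le_trans (ler_wpM2r (expR_ge0 _) (hC n.+2%:R _))); first by rewrite ltr0n.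
    rewrite -mulrA -expRD ler_wpM2l ?(ltW C0)// ler_expR.
    by rewrite (_ : n.+2%:R / 2 - n.+2%:R = - (2^-1 * n.+2%:R))//; field.
  - exact: cvg_cst.
  - rewrite -[X in _ --> X](mulr0 C); apply: cvgMl_tmp.
    have := cvg_expR_oppMn h2; rewrite -cvg_shiftS; exact.
have ch : n.+2%:R^-1 @[n --> \oo] --> (0 : R).
  by have := @cvg_harmonic R; rewrite -cvg_shiftS; exact.
apply: (squeeze_cvgr (f := fun=> 0) (h := fun n => n.+2%:R^-1 `^ z)).
- apply: nearW => n; rewrite mulr_ge0 ?powR_ge0 ?expR_ge0//=.
  by rewrite ler_piMr ?powR_ge0// expR_le1 oppr_le0 invr_ge0.
- exact: cvg_cst.
- have /cvg_at_rightP := powR_cvg0 z0; apply; split => // n; rewrite invr_gt0.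
Qed.

Lemma gamma_itvE (R : realType) (p : R) (n : nat) :
  (\int[lebesgue_measure]_(t in `[(n.+2%:R^-1)%R, (n.+2%:R)%R]) (t `^ p * expR (- t))%:E)%E
  = (\int[lebesgue_measure]_(t in `[n.+2%:R^-1, n.+2%:R]) (t `^ p * expR (- t)))%:E.
Proof.
rewrite /Rintegral fineK//; apply: integrable_fin_num => //.
apply: continuous_compact_integrable; first exact: segment_compact.
apply: continuous_in_subspaceT => x; rewrite inE/= in_itv/= => /andP[x0 _].
have {}x0 : 0 < x by apply: lt_le_trans x0; rewrite invr_gt0.
apply: cvgM; first exact: continuous_powR.
by apply: continuous_comp; [exact: opp_continuous|exact: continuous_expR].
Qed.

(** Integration by parts trades the exponent [z - 1], possibly negative, for [z], where finiteness
    is known; the boundary terms tend to zero and are eventually at most 1. *)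
Lemma gamma_lty (R : realType) (z : R) : 0 < z ->
  (\int[lebesgue_measure]_(t in `]0%R, +oo[) (t `^ (z - 1) * expR (- t))%:E < +oo)%E.
Proof.
move=> z0.
have c1 := @gamma_itv_cvg R (z - 1).
have f0 (p t : R) : (0 <= (t `^ p * expR (- t))%:E)%E.
  by rewrite lee_fin mulr_ge0 ?powR_ge0 ?expR_ge0.
have lty := gamma_lty_ge1 (ltW z0).
pose M := fine (\int[lebesgue_measure]_(t in `]0%R, +oo[) (t `^ z * expR (- t))%:E)%E.
apply: (@le_lt_trans _ _ (z^-1 * (M + 1))%:E); last exact: ltry.
have hb := cvgr_le _ (gamma_boundary_cvg z0) _ ltr01.
apply: (cvge_to_le c1).
near=> n.
have bn : n.+2%:R `^ z * expR (- n.+2%:R) - n.+2%:R^-1 `^ z * expR (- n.+2%:R^-1) <= 1.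
  by near: n; exact: hb.
rewrite gamma_itvE lee_fin ler_pdivlMl// gamma_by_parts ?invr_gt0//; last first.
  by apply: (@lt_trans _ _ 1); rewrite ?invf_lt1 ?ltr1n ?ltr0n.
rewrite lerD// /M -lee_fin -gamma_itvE fineK; last first.
  by rewrite ge0_fin_numE//; apply: integral_ge0.
apply: ge0_subset_integral => //; first exact: measurable_gamma_fun.
move=> t; rewrite /= !in_itv/= andbT => /andP[+ _]; apply: lt_le_trans.
by rewrite invr_gt0.
Unshelve. all: end_near. Qed.

Lemma Gamma_cvg (R : realType) (z : R) : 0 < z ->
  \int[lebesgue_measure]_(t in `[n.+2%:R^-1, n.+2%:R]) (t `^ (z - 1) * expR (- t))
    @[n --> \oo] --> Gamma z.
Proof.
move=> z0; apply: fine_cvg.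
have E0 : (0 <= \int[lebesgue_measure]_(t in `]0%R, +oo[) (t `^ (z - 1) * expR (- t))%:E)%E.
  by apply: integral_ge0 => t _; rewrite lee_fin mulr_ge0 ?powR_ge0 ?expR_ge0.
rewrite /Gamma /Rintegral fineK; last by rewrite ge0_fin_numE//; exact: gamma_lty.
exact: gamma_itv_cvg.
Qed.

Lemma GammaS (R : realType) (z : R) : 0 < z -> Gamma (z + 1) = z * Gamma z.
Proof.
move=> z0.
have c1 := cvgMl_tmp (a := z) (Gamma_cvg z0).
have z1 : 0 < z + 1 by rewrite addr_gt0.
have c2 := cvgD (Gamma_cvg z1) (gamma_boundary_cvg z0).
rewrite addr0 in c2.
suff e : (fun n : nat => z * \int[lebesgue_measure]_(t in `[n.+2%:R^-1, n.+2%:R])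
    (t `^ (z - 1) * expR (- t))) = (fun n : nat =>
    \int[lebesgue_measure]_(t in `[n.+2%:R^-1, n.+2%:R])
    (t `^ (z + 1 - 1) * expR (- t)) + (n.+2%:R `^ z * expR (- n.+2%:R)
       - n.+2%:R^-1 `^ z * expR (- n.+2%:R^-1))).
  by rewrite e in c1; apply: esym; exact: (cvg_unique (@norm_hausdorff _ R) (c1 _) (c2 _)).
apply/funext => n; rewrite addrK gamma_by_parts ?invr_gt0//.
by apply: (@lt_trans _ _ 1); rewrite ?invf_lt1 ?ltr1n ?ltr0n.
Qed.

Lemma Gamma_gt0 (R : realType) (z : R) : 0 < z -> 0 < Gamma z.
Proof.
move=> z0; rewrite /Gamma /Rintegral fine_gt0// gamma_lty// andbT.
(* A lower bound of the integrand on [1, 2]: there the power is at least 1/t >= 1/2 because [z > 0],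
   and exp(-t) >= exp(-2). *)
pose c : R := 2^-1 * expR (- 2).
apply: (@lt_le_trans _ _ (\int[lebesgue_measure]_(t in `[1%R, 2%R]) (cst c%:E t))%E).
  rewrite integral_cst//= lebesgue_measure_itv/= lte_fin ltr1n/= -EFinB -EFinM lte_fin.
  by rewrite /c !mulr_gt0 ?expR_gt0// subr_gt0 ltr1n.
apply: (@le_trans _ _ (\int[lebesgue_measure]_(t in `[1%R, 2%R])
    (t `^ (z - 1) * expR (- t))%:E)%E).
  apply: ge0_le_integral => //.
  - by move=> t _; rewrite lee_fin mulr_ge0 ?expR_ge0.
  - exact: measurable_gamma_fun.
  - move=> t; rewrite /= in_itv/= => /andP[t1 t2].
    have t0 : 0 < t by exact: lt_le_trans t1.
    rewrite lee_fin ler_pM ?expR_ge0//; last by rewrite ler_expR lerN2.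
    apply: (@le_trans _ _ (t `^ (-1))); last by rewrite ler_powR// lerBrDr addNr ltW.
    by rewrite powR_inv1 ?(ltW t0)// lef_pV2// posrE.
apply: ge0_subset_integral => //; first exact: measurable_gamma_fun.
  by move=> t _; rewrite lee_fin mulr_ge0 ?powR_ge0 ?expR_ge0.
by move=> t; rewrite /= !in_itv/= andbT => /andP[+ _]; apply: lt_le_trans.
Qed.

(** * Rising factorials and the normalized Bessel series *)

Definition rising (R : pzRingType) (a : R) (k : nat) : R := \prod_(j < k) (a + j%:R).

Lemma rising_ge (R : realFieldType) (a : R) k : 0 < a -> a ^+ k <= rising a k.
Proof.
move=> a0; rewrite /rising -[k in leLHS]card_ord -prodr_const.
by apply: ler_prod => j _; rewrite ltW//= lerDl.
Qed.

Lemma rising_gt0 (R : realFieldType) (a : R) k : 0 < a -> 0 < rising a k.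
Proof. by move=> a0; rewrite (lt_le_trans _ (rising_ge k a0))// exprn_gt0. Qed.

Lemma rising_recl (R : comPzRingType) (a : R) k : rising a k.+1 = a * rising (a + 1) k.
Proof.
rewrite /rising big_ord_recl addr0; congr (_ * _); apply: eq_bigr => j _.
by rewrite lift0 -addrA nat1r.
Qed.

Lemma rising_recr (R : pzRingType) (a : R) k : rising a k.+1 = rising a k * (a + k%:R).
Proof. by rewrite /rising big_ord_recr. Qed.

Lemma Gamma_rising (R : realType) (a : R) k : 0 < a ->
  Gamma (a + k%:R) = rising a k * Gamma a.
Proof.
move=> a0; elim: k => [|k IH]; first by rewrite addr0 /rising big_ord0 mul1r.
by rewrite -natr1 addrA GammaS ?ltr_pwDl// IH rising_recr; ring.
Qed.

Definition bessel_coeff (R : realType) (nu y : R) (k : nat) : R :=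
  y ^+ k / (k`!%:R * rising (nu + 1) k).

Definition bessel_fun (R : realType) (nu y : R) : R :=
  limn (series (bessel_coeff nu y)).

Section bessel_fun.
Context {R : realType} (nu y : R) (hnu : -1 < nu) (y0 : 0 <= y).

Let nu1 : 0 < nu + 1. Proof. by rewrite -ltrBlDr sub0r. Qed.

Lemma bessel_coeff_ge0 k : 0 <= bessel_coeff nu y k.
Proof. by rewrite divr_ge0 ?exprn_ge0// mulr_ge0// ltW// rising_gt0. Qed.

Lemma bessel_coeff_le k : bessel_coeff nu y k <= exp_coeff (y / (nu + 1)) k.
Proof.
rewrite /bessel_coeff /exp_coeff/= expr_div_n -mulrA ler_wpM2l ?exprn_ge0//.
rewrite [leRHS]mulrC invfM ler_wpM2l ?invr_ge0 ?ler0n//.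
by rewrite lef_pV2 ?posrE ?exprn_gt0 ?rising_gt0// rising_ge.
Qed.

Lemma bessel_coeff_cvg : cvgn (series (bessel_coeff nu y)).
Proof.
apply: (series_le_cvg (v_ := exp_coeff (y / (nu + 1)))).
- exact: bessel_coeff_ge0.
- by move=> k; apply: exp_coeff_ge0; rewrite divr_ge0// ltW.
- exact: bessel_coeff_le.
- exact: is_cvg_series_exp_coeff.
Qed.

Lemma bessel_fun_le_expR : bessel_fun nu y <= expR (y / (nu + 1)).
Proof.
apply: ler_lim; [exact: bessel_coeff_cvg|exact: is_cvg_series_exp_coeff|].
by apply: nearW => n; apply: ler_sum => k _; exact: bessel_coeff_le.
Qed.

Lemma bessel_fun_ge1 : 1 <= bessel_fun nu y.
Proof.
apply: limr_ge; first exact: bessel_coeff_cvg.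
near=> n; have n0 : (0 < n)%N by near: n; exact: nbhs_infty_gt.
rewrite /series/= big_ltn//.
have -> : bessel_coeff nu y 0 = 1.
  by rewrite /bessel_coeff /rising big_ord0 fact0 expr0 !mul1r invr1.
by rewrite lerDl sumr_ge0// => k _; exact: bessel_coeff_ge0.
Unshelve. all: end_near. Qed.

Lemma besselIE (x : R) : 0 < x -> y = (x / 2) ^+ 2 ->
  besselI nu x = (x / 2) `^ nu / Gamma (nu + 1) * bessel_fun nu y.
Proof.
move=> x0 yE.
have x2 : 0 < x / 2 by rewrite divr_gt0.
have G0 := Gamma_gt0 nu1.
rewrite /besselI /bessel_fun.
have -> : (fun k : nat => (x / 2) `^ (2 * k%:R + nu) / (k`!%:R * Gamma (k%:R + nu + 1)))
    = (fun k => (x / 2) `^ nu / Gamma (nu + 1) * bessel_coeff nu y k).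
  apply/funext => k.
  rewrite powRD; last by rewrite (gt_eqF x2) implybT.
  rewrite -natrM powR_mulrn ?(ltW x2)// exprM -yE -addrA addrC Gamma_rising//.
  rewrite /bessel_coeff; field.
  by rewrite !gt_eqF// ?rising_gt0// ltr0n fact_gt0.
have -> : series (fun k => (x / 2) `^ nu / Gamma (nu + 1) * bessel_coeff nu y k)
    = (fun n => (x / 2) `^ nu / Gamma (nu + 1) * series (bessel_coeff nu y) n).
  by apply/funext => n; rewrite /series/= mulr_sumr.
by apply/cvg_lim => //; apply: cvgMl_tmp; exact: bessel_coeff_cvg.
Qed.

End bessel_fun.

Lemma bessel_fun_rec (R : realType) (nu y : R) : -1 < nu -> 0 <= y ->
  bessel_fun nu y = bessel_fun (nu + 1) y
    + y / ((nu + 1) * (nu + 1 + 1)) * bessel_fun (nu + 1 + 1) y.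
Proof.
move=> hnu y0.
have nu1 : 0 < nu + 1 by rewrite -ltrBlDr sub0r.
have hnu1 : -1 < nu + 1 by rewrite (lt_trans _ nu1)// ltrN10.
have hnu2 : -1 < nu + 1 + 1 by rewrite (lt_trans hnu1)// ltrDl.
have c0 := bessel_coeff_cvg hnu y0.
have c1 := bessel_coeff_cvg hnu1 y0.
have c2 := bessel_coeff_cvg hnu2 y0.
set a := y / _.
(* The reciprocals of (nu+1)_(k+1) and (nu+2)_(k+1) differ by (k+1) / ((nu+1) (nu+2)_(k+1)); the
   factor k+1 turns (k+1)! into k!. *)
have coeffE k : bessel_coeff nu y k.+1 =
    bessel_coeff (nu + 1) y k.+1 + a * bessel_coeff (nu + 1 + 1) y k.
  have k0 : 0 <= k%:R :> R by [].
  have nu2 : 0 < nu + 1 + 1 by rewrite addr_gt0.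
  have nuk : 0 < nu + 1 + 1 + k%:R by rewrite ltr_pwDl.
  have r2E : rising (nu + 1 + 1 + 1) k =
      rising (nu + 1 + 1) k * (nu + 1 + 1 + k%:R) / (nu + 1 + 1).
    by rewrite -rising_recr rising_recl [RHS]mulrAC mulfV ?mul1r ?gt_eqF.
  rewrite /bessel_coeff /a r2E rising_recl rising_recr factS exprS natrM -natr1.
  field.
  by rewrite !gt_eqF// ?rising_gt0// ?ltr0n ?fact_gt0// ltr_wpDl.
have serE n : series (bessel_coeff nu y) n.+1 =
    series (bessel_coeff (nu + 1) y) n.+1
    + a * series (bessel_coeff (nu + 1 + 1) y) n.
  rewrite /series/= !big_nat_recl// mulr_sumr -addrA -big_split/=.
  congr (_ + _); last by apply: eq_bigr => k _; exact: coeffE.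
  by rewrite /bessel_coeff /rising !big_ord0.
have l0 : series (bessel_coeff nu y) n.+1 @[n --> \oo] --> bessel_fun nu y.
  have h : series (bessel_coeff nu y) n @[n --> \oo] --> bessel_fun nu y := c0.
  by have := h; rewrite -cvg_shiftS; exact.
have l1 : series (bessel_coeff (nu + 1) y) n.+1 @[n --> \oo] --> bessel_fun (nu + 1) y.
  have h : series (bessel_coeff (nu + 1) y) n @[n --> \oo] --> bessel_fun (nu + 1) y := c1.
  by have := h; rewrite -cvg_shiftS; exact.
have e : (fun n => series (bessel_coeff nu y) n.+1) =
    (fun n => series (bessel_coeff (nu + 1) y) n.+1
      + a * series (bessel_coeff (nu + 1 + 1) y) n).
  by apply/funext => n; exact: serE.
have l2 : (series (bessel_coeff (nu + 1) y) n.+1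
    + a * series (bessel_coeff (nu + 1 + 1) y) n) @[n --> \oo] -->
    bessel_fun (nu + 1) y + a * bessel_fun (nu + 1 + 1) y.
  by apply: cvgD => //; apply: cvgMl_tmp; exact: c2.
by rewrite e in l0; exact: (cvg_unique (@norm_hausdorff _ R) l0 l2).
Qed.

(** * Bessel series as limits of continuants *)

Fixpoint bessel_weights (R : realType) (c nu : R) (N : nat) : seq R :=
  if N is N'.+1 then c / (nu + 1) :: bessel_weights c (nu + 1) N' else [::].

Lemma bessel_weights_ge0 (R : realType) (c nu : R) N : 0 <= c -> -1 < nu ->
  all (fun e => 0 <= e) (bessel_weights c nu N).
Proof.
move=> c0; elim: N nu => //= N IH nu hnu.
have nu1 : 0 < nu + 1 by rewrite -ltrBlDr sub0r.
by rewrite divr_ge0 ?(ltW nu1)//= IH// (lt_trans _ nu1)// ltrN10.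
Qed.

Lemma bessel_weights_le (R : realType) (c c' nu nu' : R) N :
  0 <= c' -> c' <= c -> -1 < nu -> nu <= nu' ->
  all2 (fun e' e => 0 <= e' <= e) (bessel_weights c' nu' N) (bessel_weights c nu N).
Proof.
move=> c0 cc; elim: N nu nu' => //= N IH nu nu' hnu nn.
have nu1 : 0 < nu + 1 by rewrite -ltrBlDr sub0r.
have nu1' : 0 < nu' + 1 by rewrite (lt_le_trans nu1)// lerD2r.
rewrite divr_ge0 ?(ltW nu1')//= ler_pM ?invr_ge0 ?(ltW nu1')//=.
  by rewrite IH ?lerD2r// (lt_trans _ nu1)// ltrN10.
by rewrite lef_pV2 ?posrE// lerD2r.
Qed.

Lemma continuant_bessel_rec (R : realType) (c nu x : R) N :
  continuant x (bessel_weights c nu N.+2) =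
  continuant x (bessel_weights c (nu + 1) N.+1)
  + c ^+ 2 * x / ((nu + 1) * (nu + 1 + 1))
    * continuant x (bessel_weights c (nu + 1 + 1) N).
Proof. by rewrite /= invfM; ring. Qed.

(** Both sides obey the same recurrence with nonnegative coefficients. Unfolding it ends in words of
    length 1 or 0, where the continuant is 1 and the series has order [nu + N - 1] or more ([nu]
    itself if [N = 0]); the error is thus at most a factor [D] bounding those series. *)
Lemma continuant_bessel_bounds (R : realType) (c x : R) N nu D :
  0 <= c -> 0 <= x -> -1 < nu ->
  (forall j, (N <= j.+1)%N -> bessel_fun (nu + j%:R) (c ^+ 2 * x) <= D) ->
  continuant x (bessel_weights c nu N) <= bessel_fun nu (c ^+ 2 * x) /\
  bessel_fun nu (c ^+ 2 * x) <= continuant x (bessel_weights c nu N) * D.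
Proof.
move=> c0 x0; set y := c ^+ 2 * x.
have y0 : 0 <= y by rewrite mulr_ge0// exprn_ge0.
have [m] := ubnP N; elim: m N nu => // m IH [|[|N]] nu mN hnu hD.
- rewrite /= mul1r; split; first exact: bessel_fun_ge1.
  by have := hD 0%N isT; rewrite addr0.
- rewrite /= addr0 mul1r; split; first exact: bessel_fun_ge1.
  by have := hD 0%N isT; rewrite addr0.
have nu1 : 0 < nu + 1 by rewrite -ltrBlDr sub0r.
have hnu1 : -1 < nu + 1 by rewrite (lt_trans _ nu1)// ltrN10.
have hnu2 : -1 < nu + 1 + 1 by rewrite (lt_trans hnu1)// ltrDl.
have [||a1 b1] := IH N.+1 (nu + 1) _ hnu1.
- by rewrite -ltnS.
- by move=> j Nj; rewrite -addrA nat1r; apply: hD.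
have [||a2 b2] := IH N (nu + 1 + 1) _ hnu2.
- by rewrite -ltnS ltnW.
- by move=> j Nj; rewrite -addrA nat1r -addrA nat1r; apply: hD.
rewrite continuant_bessel_rec (bessel_fun_rec hnu y0) -/y.
have a0 : 0 <= y / ((nu + 1) * (nu + 1 + 1)).
  by rewrite divr_ge0// mulr_ge0// ltW// addr_gt0.
by split; [rewrite lerD// ler_wpM2l|rewrite [leRHS]mulrDl lerD// -[leRHS]mulrA ler_wpM2l].
Qed.

Lemma continuant_bessel_cvg (R : realType) (c x nu : R) :
  0 <= c -> 0 <= x -> -1 < nu ->
  continuant x (bessel_weights c nu N.+1) @[N --> \oo] --> bessel_fun nu (c ^+ 2 * x).
Proof.
move=> c0 x0 hnu; set y := c ^+ 2 * x.
have y0 : 0 <= y by rewrite mulr_ge0// exprn_ge0.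
have nu1 : 0 < nu + 1 by rewrite -ltrBlDr sub0r.
have nuN N : 0 < nu + 1 + N%:R by rewrite ltr_pwDl.
pose D N := expR (y / (nu + 1 + N%:R)).
have hD N j : (N.+1 <= j.+1)%N -> bessel_fun (nu + j%:R) y <= D N.
  move=> Nj; apply: le_trans (bessel_fun_le_expR _ y0) _.
    by rewrite (lt_le_trans hnu)// lerDl.
  rewrite ler_expR ler_wpM2l// lef_pV2 ?posrE//; last first.
    by rewrite addrAC.
  by rewrite addrAC lerD2r lerD2l ler_nat.
apply: (squeeze_cvgr (f := fun N => bessel_fun nu y * (D N)^-1)
  (h := fun=> bessel_fun nu y)).
- apply: nearW => N.
  have [a1 a2] := continuant_bessel_bounds c0 x0 hnu (hD N).
  by rewrite a1 andbT ler_pdivrMr ?expR_gt0.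
- rewrite -[X in _ --> X]mulr1; apply: cvgMl_tmp.
  rewrite [X in _ --> X](_ : 1 = expR (- (y * 0))); last first.
    by rewrite mulr0 oppr0 expR0.
  rewrite /D; under eq_cvg do rewrite -expRN.
  apply: continuous_cvg; first exact: continuous_expR.
  apply: cvgN; apply: cvgMl_tmp.
  (* This minimum gives [c1 * N.+1 <= nu + 1 + N], so that the exponent of [D N] is at most a
     multiple of [1/(N+1)]. *)
  pose c1 := Num.min (nu + 1) 1.
  have c10 : 0 < c1 by rewrite lt_min nu1 ltr01.
  apply: (squeeze_cvgr (f := fun=> 0) (h := fun N => c1^-1 * N.+1%:R^-1)).
  + apply: nearW => N; rewrite invr_ge0 (ltW (nuN N))/= -invfM.
    rewrite lef_pV2 ?posrE// ?mulr_gt0// -natr1 mulrDr mulr1 addrC lerD//.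
      by rewrite ge_min lexx.
    by rewrite ler_piMl// ge_min lexx orbT.
  + exact: cvg_cst.
  + rewrite -[X in _ --> X](mulr0 c1^-1); apply: cvgMl_tmp.
    exact: cvg_harmonic.
- exact: cvg_cst.
Qed.

(** The bound exp(y/(nu+1)) has a small rate for large orders. The recurrence brings the order back
    down, each time at the price of a factor y, which an arbitrarily small increase of the rate
    absorbs. In the generalized claim [d] is a rate reached after [M] shifts of the order and the
    gap between [d] and [e] is the room for these increases. *)
Lemma bessel_fun_growth (R : realType) (nu e : R) : -1 < nu -> 0 < e ->
  exists2 C : R, 0 < C & forall y, 0 <= y -> bessel_fun nu y <= C * expR (e * y).
Proof.
move=> hnu e0.
suff H M : forall nu d e : R, -1 < nu -> 0 < d -> d < e -> (nu + 1 + M%:R)^-1 <= d ->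
    exists2 C : R, 0 < C & forall y, 0 <= y -> bessel_fun nu y <= C * expR (e * y).
  apply: (H (Num.bound (2 / e)) nu (e / 2) e) => //.
  - by rewrite divr_gt0.
  - by rewrite ltr_pdivrMr// ltr_pMr// ltr1n.
  - have nu1 : 0 < nu + 1 by rewrite -ltrBlDr sub0r.
    have nuM (k : nat) : 0 < nu + 1 + k%:R by rewrite ltr_pwDl.
    rewrite invf_ple ?posrE ?divr_gt0// invf_div.
    apply: (le_trans (ltW (archi_boundP _))); first by rewrite divr_ge0// ltW.
    by rewrite lerDr ltW.
move=> {hnu e0 nu e}; elim: M => [|M IH] nu d e hnu d0 de hd; have e0 := lt_trans d0 de.
  rewrite addr0 in hd; exists 1 => // y y0; rewrite mul1r.
  apply: (le_trans (bessel_fun_le_expR hnu y0)).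
  by rewrite ler_expR mulrC ler_wpM2r// (le_trans hd)// ltW.
have nu1 : 0 < nu + 1 by rewrite -ltrBlDr sub0r.
have hnu1 : -1 < nu + 1 by rewrite (lt_trans _ nu1)// ltrN10.
have hnu2 : -1 < nu + 1 + 1 by rewrite (lt_trans hnu1)// ltrDl.
(* The midpoint leaves room on both sides: below for the induction, above to absorb [y] into
   [expR ((e - e') * y)] divided by [e - e']. *)
pose e' := (d + e) / 2.
have [de' e'e] := midf_lt de.
have hd1 : (nu + 1 + 1 + M%:R)^-1 <= d.
  by rewrite -addrA nat1r.
have hd2 : (nu + 1 + 1 + 1 + M%:R)^-1 <= d.
  have p1 : 0 < nu + 1 + 1 + M%:R by rewrite ltr_pwDl// addr_gt0.
  have p2 : 0 < nu + 1 + 1 + 1 + M%:R by rewrite ltr_pwDl// addr_gt0// addr_gt0.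
  by apply: (le_trans _ hd1); rewrite lef_pV2 ?posrE// lerD2r lerDl ler01.
have [C1 C10 h1] := IH (nu + 1) d e' hnu1 d0 de' hd1.
have [C2 C20 h2] := IH (nu + 1 + 1) d e' hnu2 d0 de' hd2.
have ee' : 0 < e - e' by rewrite subr_gt0.
pose a := ((nu + 1) * (nu + 1 + 1))^-1.
have a0 : 0 < a by rewrite invr_gt0 mulr_gt0// addr_gt0.
exists (C1 + a * (C2 / (e - e'))).
  by rewrite addr_gt0// mulr_gt0// divr_gt0.
move=> y y0; rewrite bessel_fun_rec// [leRHS]mulrDl lerD//.
  apply: (le_trans (h1 y y0)); rewrite ler_wpM2l ?(ltW C10)// ler_expR.
  by rewrite ler_wpM2r// ltW.
rewrite -/a [y * a]mulrC -!mulrA ler_wpM2l ?(ltW a0)//.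
apply: (le_trans (ler_wpM2l y0 (h2 y y0))).
rewrite mulrCA ler_wpM2l ?(ltW C20)//.
rewrite ler_pdivlMl// mulrA.
have -> : e * y = (e - e') * y + e' * y by rewrite mulrBl subrK.
rewrite expRD ler_wpM2r ?expR_ge0//.
by apply: le_trans (expR_ge1Dx _); rewrite lerDr.
Qed.

(** * The support and the decomposition of Omega *)

(** A law without mass on [0, d[ has a transform of at most exp(-x d); one violation of this bound
    is enough. *)
Lemma half_line_near0_gt0 (R : realType) (lam : probability (measurableTypeR R) R)
    (d : R) : on_half_line lam -> 0 < d ->
  (exists2 x, 0 < x & expR (- (x * d)) < laplace lam x) ->
  (0 < lam `[0%R, d[%classic)%E.
Proof.
move=> h d0 [x x0]; rewrite ltNge => /negP lap; rewrite lt0e.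
apply/andP; split; last exact: measure_ge0.
apply/eqP => lam0; apply: lap; rewrite -lee_fin laplaceE ?(ltW x0)//.
have mD : measurable (`[0%R, +oo[%classic : set (measurableTypeR R)).
  exact: measurable_itv.
have mN : measurable (`[0%R, d[%classic : set (measurableTypeR R)).
  exact: measurable_itv.
rewrite (ge0_negligible_integral mN mD)//; last exact: measurable_expRM.
set D := (_ `\` _).
have mDN : measurable (D : set (measurableTypeR R)) by exact: measurableD.
apply: (@le_trans _ _ (\int[lam]_(t in D) (cst (expR (- (x * d)))%:E t))%E).
  apply: ge0_le_integral => //.
  - exact: measurable_expRM.
  - move=> t [/=]; rewrite !in_itv/= andbT => t0; rewrite t0/= => /negP.
    by rewrite -leNgt => dt; rewrite lee_fin ler_expR lerN2 ler_wpM2l// ltW.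
rewrite integral_cst//.
rewrite -[leRHS]mule1; apply: lee_wpmul2l; first by rewrite lee_fin expR_ge0.
exact: probability_le1.
Qed.

(** The first law reaches every interval and the second one can contribute an arbitrarily small
    amount, so their sum comes close to any [t >= 0] with positive probability. Nothing is asked of
    the second law away from 0. *)
Lemma measure_support_half_line (R : realType)
    (l1 l2 P : probability (measurableTypeR R) R) :
  on_half_line P ->
  (forall A B U : set (measurableTypeR R),
    measurable A -> measurable B -> measurable U ->
    (forall s t : R, A s -> B t -> U (s + t)) -> (l1 A * l2 B <= P U)%E) ->
  (forall c d : R, 0 <= c -> c < d -> (0 < l1 `]c, d[%classic)%E) ->
  (forall d : R, 0 < d -> (0 < l2 `[0%R, d[%classic)%E) ->
  measure_support P = `[0, +oo[%classic.
Proof.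
move=> hP PU h1 h2; apply/seteqP; split => t /=.
  move=> /(_ `]-oo, 0[%classic) H; rewrite in_itv/= andbT leNgt; apply/negP => t0.
  have /H : open (`]-oo, 0[%classic : set R) by exact: interval_open.
  rewrite /= in_itv/= => /(_ t0).
  have -> : `]-oo, 0[%classic = ~` `[0, +oo[%classic :> set R by rewrite setCitvr.
  by rewrite half_line_setC// ltxx.
rewrite in_itv/= andbT => t0 U oU Ut.
have /nbhs_ballP[e /= e0 eU] : nbhs t U by exact: open_nbhs_nbhs.
have e20 : 0 < e / 2 by rewrite divr_gt0.
have mU : measurable (U : set (measurableTypeR R)) by exact: open_measurable.
pose A : set R := `]t, t + e / 2[%classic; pose B : set R := `[0, e / 2[%classic.
apply: (@lt_le_trans _ _ (l1 A * l2 B)%E).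
  by apply: mule_gt0; [apply: h1 => //; rewrite ltrDl|exact: h2].
apply: PU => [| |//|s r]; [exact: measurable_itv|exact: measurable_itv|].
rewrite /A /B/= !in_itv/= => /andP[s1 s2] /andP[r1 r2].
apply: eU; rewrite /ball/= distrC ger0_norm; last by rewrite subr_ge0; lra.
by lra.
Qed.

Lemma is_id_laplace_inv (R : realType) (b : R) : 0 <= b ->
  is_id_laplace (fun x => (1 + b * x)^-1).
Proof.
move=> b0; have s0 (p : R * R) : p \in [:: (1, 0)] -> 0 <= p.1 /\ 0 <= p.2.
  by rewrite inE => /eqP ->.
apply: is_id_laplace_ext (is_id_laplace_ratio s0 (lexx 0) b0) => x x0.
by rewrite /stieltjes_sum big_seq1/= !mul0r !addr0 !mul1r divr1.
Qed.

(** The trailing zeros give the two-letter word the length of a longer one, with which it can then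
    be compared entrywise. *)
Lemma continuant_nseq0 (R : comPzRingType) (y e1 e2 : R) N :
  continuant y (e1 :: e2 :: nseq N 0) = 1 + y * e1 * e2.
Proof.
have h0 : continuant_head y (nseq N 0) = 0 by case: N => //= N; rewrite mul0r.
have k0 : continuant y (nseq N 0) = 1.
  by elim: N {h0} => //= N ->; case: N => /= [|N]; rewrite ?mulr0 ?mul0r addr0.
by rewrite continuant_cons continuant_cons h0 mulr0 addr0 k0 /= k0 mulr1.
Qed.

Lemma OmegaE (R : realType) (mu nu sigma a b x : R) :
  -1 < mu -> -1 < nu -> -1 < sigma -> 0 < a -> 0 < b -> 0 < x ->
  forall ya yb, ya = (a / 2) ^+ 2 * x -> yb = (b / 2) ^+ 2 * x ->
  Omega mu nu sigma a b x =
    (bessel_fun mu ya / bessel_fun mu yb) * (bessel_fun nu yb / bessel_fun sigma yb)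
    / bessel_fun nu ya.
Proof.
move=> hmu hnu hsigma a0 b0 x0 ya yb eya eyb.
have sx : 0 < Num.sqrt x by rewrite sqrtr_gt0.
pose A := a * Num.sqrt x / 2; pose B := b * Num.sqrt x / 2.
have ax : 0 < a * Num.sqrt x by rewrite mulr_gt0.
have bx : 0 < b * Num.sqrt x by rewrite mulr_gt0.
have A0 : 0 < A by rewrite divr_gt0.
have B0 : 0 < B by rewrite divr_gt0.
have x2 : Num.sqrt x ^+ 2 = x by rewrite sqr_sqrtr// ltW.
have yaE : ya = A ^+ 2 by rewrite eya -[in LHS]x2 /A; field.
have ybE : yb = B ^+ 2 by rewrite eyb -[in LHS]x2 /B; field.
have ya0 : 0 <= ya by rewrite yaE sqr_ge0.
have yb0 : 0 <= yb by rewrite ybE sqr_ge0.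
rewrite /Omega.
rewrite (besselIE hmu ya0 ax yaE) (besselIE hnu yb0 bx ybE).
rewrite (besselIE hmu yb0 bx ybE) (besselIE hnu ya0 ax yaE).
rewrite (besselIE hsigma yb0 bx ybE) -/A -/B.
have ba0 : 0 < b / a by rewrite divr_gt0.
have BA : B = (b / a) * A by rewrite /B /A; field; rewrite gt_eqF.
have bB : b * Num.sqrt x = 2 * B by rewrite /B; field.
have -> : (b / a) `^ (mu - nu) = (b / a) `^ mu / (b / a) `^ nu.
  by rewrite powRB// (gt_eqF ba0) implybT.
have -> : (b * Num.sqrt x) `^ sigma = 2 `^ sigma * B `^ sigma.
  by rewrite bB powRM// ltW.
have BE p : B `^ p = (b / a) `^ p * A `^ p by rewrite BA powRM// ltW.
rewrite (BE mu) (BE nu).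
have gt1 p (z : R) : -1 < p -> 0 <= z -> bessel_fun p z != 0.
  by move=> hp z0; rewrite gt_eqF// (lt_le_trans ltr01)// bessel_fun_ge1.
have G0 p : -1 < p -> Gamma (p + 1) != 0.
  by move=> hp; rewrite gt_eqF// Gamma_gt0// -ltrBlDr sub0r.
have p0 (z p : R) : 0 < z -> z `^ p != 0 by move=> z0; rewrite gt_eqF// powR_gt0.
field.
by rewrite !gt1// !G0// !p0.
Qed.

(* Removing one exponential factor from [Omega] leaves an infinitely divisible
   law: it is the ratio of [1 + y e_1 e_2] to the continuant in the limit. *)
Lemma is_id_laplace_cofactor (R : realType) (mu nu sigma a b : R) :
  -1 < mu -> -1 < sigma -> sigma < nu -> 0 < a -> a < b ->
  let beta := a ^+ 2 / ((nu + 1) * (nu + 1 + 1)) in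
  let g := fun x => (1 + beta * x) *
    ((bessel_fun mu (a ^+ 2 * x) / bessel_fun mu (b ^+ 2 * x))
    * (bessel_fun nu (b ^+ 2 * x) / bessel_fun sigma (b ^+ 2 * x))
    / bessel_fun nu (a ^+ 2 * x)) in
  is_id_laplace g /\
  forall x, 0 < x -> (bessel_fun mu (b ^+ 2 * x) * bessel_fun sigma (b ^+ 2 * x)
     * bessel_fun nu (a ^+ 2 * x))^-1 <= g x.
Proof.
move=> hmu hsigma hsn a0 ab beta g.
have hnu : -1 < nu by exact: lt_trans hsn.
have b0 : 0 < b by exact: lt_trans ab.
have nu1 : 0 < nu + 1 by rewrite -ltrBlDr sub0r.
have nu2 : 0 < nu + 1 + 1 by rewrite addr_gt0.
have beta0 : 0 < beta by rewrite divr_gt0 ?exprn_gt0// mulr_gt0.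
pose W (c p : R) (N : nat) := bessel_weights c p N.+2.
pose V N : seq R := (a / (nu + 1)) :: (a / (nu + 1 + 1)) :: nseq N 0.
pose K x (l : seq R) := continuant x l.
have K_gt0 x l : 0 < x -> all (fun e => 0 <= e) l -> 0 < K x l.
  by move=> x0 l0; rewrite (lt_le_trans ltr01)// continuant_ge1// ltW.
have KW x c p N : 0 < x -> 0 < c -> -1 < p -> 0 < K x (W c p N).
  by move=> x0 c0 hp; apply: K_gt0 => //; apply: bessel_weights_ge0 => //; exact: ltW.
have KV x N : K x (V N) = 1 + beta * x.
  by rewrite /K continuant_nseq0 /beta; field; rewrite !gt_eqF.
have bx0 x : 0 < x -> 0 < 1 + beta * x.
  by move=> x0; rewrite ltr_pwDl// mulr_ge0// ltW.
have F_ge1 p c x : -1 < p -> 0 < x -> 1 <= bessel_fun p (c ^+ 2 * x).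
  by move=> hp x0; rewrite bessel_fun_ge1// mulr_ge0 ?sqr_ge0// ltW.
have F_gt0 p c x : -1 < p -> 0 < x -> 0 < bessel_fun p (c ^+ 2 * x).
  by move=> hp x0; rewrite (lt_le_trans ltr01)// F_ge1.
have F_ge0 p c x : -1 < p -> 0 < x -> 0 <= bessel_fun p (c ^+ 2 * x).
  by move=> hp x0; exact/ltW/F_gt0.
(* The numerator is dropped, since each of its factors is at least 1. This bound serves both to keep
   the mass in the limit and, for the support, to limit the decay of [g]. *)
have lb x : 0 < x -> (bessel_fun mu (b ^+ 2 * x) * bessel_fun sigma (b ^+ 2 * x)
     * bessel_fun nu (a ^+ 2 * x))^-1 <= g x.
  move=> x0; rewrite /g.
  set f1 := bessel_fun mu (a ^+ 2 * x); set f2 := bessel_fun mu (b ^+ 2 * x).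
  set f3 := bessel_fun nu (b ^+ 2 * x); set f4 := bessel_fun sigma (b ^+ 2 * x).
  set f5 := bessel_fun nu (a ^+ 2 * x).
  have -> : (1 + beta * x) * (f1 / f2 * (f3 / f4) / f5) =
      ((1 + beta * x) * f1 * f3) * (f2 * f4 * f5)^-1.
    by field; rewrite !gt_eqF ?F_gt0.
  rewrite ler_peMl ?invr_ge0 ?mulr_ge0 ?F_ge0//.
  by rewrite mulr_ege1 ?mulr_ege1 ?F_ge1// lerDl mulr_ge0// ltW.
have Kcvg c p x : 0 < c -> -1 < p -> 0 < x ->
    K x (W c p N) @[N --> \oo] --> bessel_fun p (c ^+ 2 * x).
  move=> c0 hp x0; have := continuant_bessel_cvg (ltW c0) (ltW x0) hp.
  by rewrite -cvg_shiftS; exact.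
pose g_ N x := (K x (V N) / K x (W a nu N)) *
  ((K x (W a mu N) / K x (W b mu N)) * (K x (W b nu N) / K x (W b sigma N))).
have Ig N : is_id_laplace (g_ N).
  have I c c' p p' : 0 < c' -> c' <= c -> -1 < p -> p <= p' ->
      is_id_laplace (fun x => K x (W c' p' N) / K x (W c p N)).
    move=> c'0 cc hp pp; apply: (is_id_continuant_ratio (l := [::])) => //.
    exact: (bessel_weights_le N.+2 (ltW c'0) cc hp pp).
  have pos c p c' p' x : 0 < c -> -1 < p -> 0 < c' -> -1 < p' -> 0 < x ->
      0 <= K x (W c p N) / K x (W c' p' N).
    by move=> *; rewrite divr_ge0// ltW// KW.
  apply: is_id_laplaceM => [x x0|x x0||].
  - by rewrite divr_ge0 ?KV ?(ltW (bx0 x x0))// ltW// KW.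
  - by rewrite mulr_ge0// pos.
  - apply: (is_id_continuant_ratio (l := [::])) => //=.
    rewrite !divr_ge0 ?(ltW a0) ?(ltW nu1) ?(ltW nu2)//= !lexx/=.
    have : -1 < nu + 1 + 1 by rewrite (lt_trans _ nu2)// ltrN10.
    clear I pos; elim: N (nu + 1 + 1) => //= N IH p hp.
    have p1 : 0 < p + 1 by rewrite -ltrBlDr sub0r.
    by rewrite lexx divr_ge0 ?(ltW a0) ?(ltW p1)//= IH// (lt_trans _ p1)// ltrN10.
  - apply: is_id_laplaceM => [x x0|x x0||]; [exact: pos|exact: pos|exact: I (ltW ab) _ _|].
    by apply: I => //; exact: ltW.
have gcvg x : 0 < x -> g_ N x @[N --> \oo] --> g x.
  move=> x0; rewrite /g_ /g.
  rewrite [X in _ --> X](_ : _ = ((1 + beta * x) / bessel_fun nu (a ^+ 2 * x)) *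
    ((bessel_fun mu (a ^+ 2 * x) / bessel_fun mu (b ^+ 2 * x)) *
     (bessel_fun nu (b ^+ 2 * x) / bessel_fun sigma (b ^+ 2 * x)))); last first.
    by field; rewrite !gt_eqF ?F_gt0.
  have ratio (u v : nat -> R) (l m : R) : 0 < m -> u n @[n --> \oo] --> l ->
      v n @[n --> \oo] --> m -> u n / v n @[n --> \oo] --> l / m.
    by move=> m0 cu cv; apply: cvgM => //; apply: cvgV => //; rewrite gt_eqF.
  apply: cvgM; last by apply: cvgM; apply: ratio; rewrite ?F_gt0//; exact: Kcvg.
  apply: ratio; [exact: F_gt0| |exact: Kcvg].
  by under eq_cvg do rewrite KV; exact: cvg_cst.
split => //.
(* The sum of the exponential rates of the three series in the denominator, so that
   [g x >= expR (- (C * x)) >= 1 - C * x]. *)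
pose C := b ^+ 2 / (mu + 1) + b ^+ 2 / (sigma + 1) + a ^+ 2 / (nu + 1).
apply: (is_id_laplace_lim (C := C) Ig gcvg) => x x0.
have gpos : 0 < g x.
  apply: lt_le_trans (lb x x0).
  by rewrite invr_gt0 !mulr_gt0// F_gt0.
rewrite gpos/=; split.
  apply: le_trans (lb x x0).
  have le_e p c : -1 < p -> bessel_fun p (c ^+ 2 * x) <= expR (c ^+ 2 / (p + 1) * x).
    move=> hp; rewrite [X in expR X]mulrAC; apply: bessel_fun_le_expR => //.
    by rewrite mulr_ge0 ?sqr_ge0// ltW.
  apply: (@le_trans _ _ (expR (- (C * x)))); first exact: expR_ge1Dx.
  rewrite expRN lef_pV2 ?posrE ?expR_gt0 ?mulr_gt0 ?F_gt0//.
  by rewrite /C !mulrDl !expRD !ler_pM ?mulr_ge0 ?F_ge0// le_e.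
apply: (cvgr_to_le (gcvg x x0)); apply: nearW => N.
have gN0 z : 0 < z -> 0 <= g_ N z.
  move=> z0; have kw c p : 0 < c -> -1 < p -> 0 <= K z (W c p N).
    by move=> c0 hp; exact/ltW/KW.
  by rewrite /g_ !mulr_ge0 ?invr_ge0 ?KV ?(ltW (bx0 z z0)) ?kw.
by have /andP[] := laplace_itv01 (is_id_laplaceW gN0 (Ig N)) x0.
Qed.

Theorem theorem8 (R : realType) (mu nu sigma a b : R)
    (hmu : -1 < mu) (hsigma : -1 < sigma) (hnu : sigma < nu)
    (ha : 0 < a) (hab : a < b) :
  exists lam : probability (measurableTypeR R) R,
    [/\ on_half_line lam,
        infinitely_divisible lam,
        measure_support lam = `[0, +oo[%classic &
        forall x : R, 0 < x -> laplace lam x = Omega mu nu sigma a b x].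
Proof.
have a20 : 0 < a / 2 by rewrite divr_gt0.
have ab2 : a / 2 < b / 2 by rewrite ltr_pM2r.
have nu1 : -1 < nu by exact: lt_trans hnu.
have [] := is_id_laplace_cofactor hmu hsigma hnu a20 ab2.
set beta := _ / _; set g := fun x => _ => Ig g_ge.
have nu0 : 0 < nu + 1 by rewrite -ltrBlDr sub0r.
have beta0 : 0 < beta.
  by rewrite divr_gt0 ?exprn_gt0// mulr_gt0// addr_gt0.
have F_gt0 p c x : -1 < p -> 0 < x -> 0 < bessel_fun p (c ^+ 2 * x).
  move=> hp x0; apply: lt_le_trans ltr01 _; apply: bessel_fun_ge1 => //.
  by rewrite mulr_ge0 ?sqr_ge0// ltW.
have F_ge0 p c x : -1 < p -> 0 < x -> 0 <= bessel_fun p (c ^+ 2 * x).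
  by move=> hp x0; exact/ltW/F_gt0.
have bx0 x : 0 < x -> 0 < 1 + beta * x.
  by move=> x0; rewrite ltr_pwDl// mulr_ge0// ltW.
have OE x : 0 < x -> (1 + beta * x)^-1 * g x = Omega mu nu sigma a b x.
  move=> x0; rewrite (OmegaE hmu nu1 hsigma ha (lt_trans ha hab) x0 erefl erefl).
  by rewrite /g mulKf// gt_eqF// bx0.
have g_gt0 x : 0 < x -> 0 < g x.
  by move=> x0; apply: lt_le_trans (g_ge x x0); rewrite invr_gt0 !mulr_gt0 ?F_gt0.
have g0 x : 0 < x -> 0 <= g x by move=> x0; exact/ltW/g_gt0.
have inv0 x : 0 < x -> 0 <= (1 + beta * x)^-1.
  by move=> x0; rewrite invr_ge0 ltW// bx0.
have [l1 [hl1 e1 l1_gt0]] := exponential_law beta0.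
have [l2 [hl2 e2]] := is_id_laplaceW g0 Ig.
have [P [hP eP PU]] := convolution_exists hl1 hl2.
have PE x : 0 < x -> laplace P x = Omega mu nu sigma a b x.
  by move=> x0; rewrite eP// e1// e2// OE.
exists P; split => //.
  have IO := is_id_laplaceM inv0 g0 (is_id_laplace_inv (ltW beta0)) Ig.
  move=> n n0; have [ln [hln eln]] := IO n n0; exists ln; split => // x x0.
  rewrite PE// eln// OE// -powR_mulrn ?powR_ge0// -powRrM mulVf ?powRr1//.
    by rewrite -OE// mulr_ge0 ?inv0 ?g0.
  by rewrite pnatr_eq0 -lt0n.
apply: measure_support_half_line hP PU l1_gt0 _ => d d0.
apply: half_line_near0_gt0 => //.
(* If [l2] gave no mass to [[0, d[], its transform [g] would decay like
   [expR (- d x)], contradicting the subexponential growth of [bessel_fun]. *)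
apply: contrapT => noge.
(* Chosen so that the growth rates of the three series in the bound on [g] add up to [d / 4],
   strictly less than the decay rate [d]. *)
pose e := d / (4 * ((a / 2) ^+ 2 + 2 * (b / 2) ^+ 2)).
have den0 : 0 < (a / 2) ^+ 2 + 2 * (b / 2) ^+ 2.
  have b20 := lt_trans a20 ab2.
  by rewrite addr_gt0 ?exprn_gt0// mulr_gt0// exprn_gt0.
have e0 : 0 < e by rewrite divr_gt0// mulr_gt0.
have [C1 C10 h1] := bessel_fun_growth hmu e0.
have [C2 C20 h2] := bessel_fun_growth hsigma e0.
have [C3 C30 h3] := bessel_fun_growth nu1 e0.
pose C := C1 * C2 * C3.
have C0 : 0 < C by rewrite !mulr_gt0.
have bound x : 0 < x -> expR (d * x) <= C * expR (d / 4 * x).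
  move=> x0.
  have ca0 : 0 <= (a / 2) ^+ 2 * x by rewrite mulr_ge0 ?sqr_ge0// ltW.
  have cb0 : 0 <= (b / 2) ^+ 2 * x by rewrite mulr_ge0 ?sqr_ge0// ltW.
  have gx : g x <= expR (- (x * d)).
    rewrite leNgt; apply/negP => gx; apply: noge; exists x => //.
    by rewrite e2.
  have := le_trans (g_ge x x0) gx.
  rewrite expRN lef_pV2 ?posrE ?expR_gt0 ?mulr_gt0 ?F_gt0// mulrC => /le_trans; apply.
  have -> : d / 4 * x = e * ((b / 2) ^+ 2 * x) + e * ((b / 2) ^+ 2 * x)
      + e * ((a / 2) ^+ 2 * x).
    rewrite /e; move: ((a / 2) ^+ 2) ((b / 2) ^+ 2) den0 => A B den0.
    by field; rewrite gt_eqF.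
  rewrite !expRD /C.
  have -> : forall u v : R, C1 * C2 * C3 * (u * u * v) = (C1 * u) * (C2 * u) * (C3 * v).
    by move=> u v; ring.
  by rewrite !ler_pM ?mulr_ge0 ?F_ge0 ?h1 ?h2 ?h3.
(* At this point the bound says [expR (C + C / 2) <= C], against [1 + t <= expR t]. *)
have := bound (2 * C / d); rewrite divr_gt0 ?mulr_gt0// => /(_ isT).
rewrite (_ : d * (2 * C / d) = 2 * C); last by field; rewrite gt_eqF.
rewrite (_ : d / 4 * (2 * C / d) = C / 2); last by field; rewrite gt_eqF.
rewrite -ler_pdivrMr ?expR_gt0// -expRB.
have -> : 2 * C - C / 2 = C + C / 2 by field.
move=> /(le_trans (expR_ge1Dx _)); apply/negP; rewrite -ltNge.
by rewrite addrCA ltrDl addr_gt0// divr_gt0.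
Qed.
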